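(* Let $E$ be a finite-dimensional Banach space. The free Banach $f$-algebra $\mathrm{FBfA}[E]$ is lattice-algebra isomorphic to the space $C([0,1]\times S_{E^*})$ equipped with pointwise order and product \[ (f\star g)(r,u)=r\,f(r,u)\,g(r,u), \] where $(r,u)\in[0,1]\times S_{E^*}$ and $f,g\in C([0,1]\times S_{E^*})$. Under this isomorphism, $\eta_x(r,u)=u(x)$ for every $x\in E$.
   Context: All spaces are real. A vector lattice algebra is a real associative algebra that is also a vector lattice in which the product of positive elements is positive. An $f$-algebra is a vector lattice algebra such that $a\wedge b=0$ and $c\ge 0$ imply $(ac)\wedge b=0=(ca)\wedge b$. A Banach $f$-algebra is an $f$-algebra equipped with a complete, submultiplicative lattice norm. A lattice-algebra homomorphism is a linear map preserving the lattice operations and the product; a lattice-algebra isomorphism is a bijective one (it is then automatically a homeomorphism between Banach lattices). Contractive means of operator norm at most $1$. The free Banach $f$-algebra generated by a Banach space $E$ is a Banach $f$-algebra $\mathrm{FBfA}[E]$ together with a linear isometric embedding $\eta_E\colon E\to\mathrm{FBfA}[E]$ (write $\eta_x=\eta_E(x)$) such that for every Banach $f$-algebra $A$ and every contractive operator $T\colon E\to A$ there exists a unique lattice-algebra homomorphism $\hat T\colon\mathrm{FBfA}[E]\to A$ satisfying $\hat T\circ\eta_E=T$ and $\|\hat T\|=\|T\|$. It exists and is unique up to isometric lattice-algebra isomorphism. $S_{E^*}$ is the unit sphere of $E^*$, and $C([0,1]\times S_{E^*})$ is the space of real continuous functions with the supremum norm. *)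

(* Defs.v *)
From HB Require Import structures.
From mathcomp Require Import all_boot all_order all_algebra.
From mathcomp Require Import all_classical all_reals all_analysis.

Set Implicit Arguments.
Unset Strict Implicit.
Unset Printing Implicit Defensive.

Import Order.TTheory GRing.Theory Num.Theory.
Import numFieldNormedType.Exports.

Local Open Scope classical_set_scope.
Local Open Scope ring_scope.

Reserved Notation "x <=v y" (at level 70, y at next level).

(* The lattice is not an instance of Order.Lattice: Hierarchy Builder cannot
   join that class with GRing.Lmodule, because Num.RealDomain already inherits
   from Order.Lattice and GRing.Zmodule without a structure joining the two. *)
HB.mixin Record isVectorLattice (R : numDomainType) V & GRing.Lmodule R V := {
  vle : rel V ;
  vmeet : V -> V -> V ;
  vjoin : V -> V -> V ;
  vle_refl : reflexive vle ;
  vle_anti : antisymmetric vle ;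
  vle_trans : transitive vle ;
  vle_meet : forall x y z : V, vle x (vmeet y z) = vle x y && vle x z ;
  vjoin_le : forall x y z : V, vle (vjoin x y) z = vle x z && vle y z ;
  vle_addr : forall z x y : V, vle x y -> vle (x + z) (y + z) ;
  vle_scale : forall (a : R) (x : V), 0 <= a -> vle 0 x -> vle 0 (a *: x)
}.

#[short(type="vectorLatticeType")]
HB.structure Definition VectorLattice (R : numDomainType) :=
  {V of GRing.Lmodule R V & isVectorLattice R V}.

Notation "x <=v y" := (vle x y) : ring_scope.

(* The algebras below need not have a unit, so the product is not the one of
   the ring structures of the library. *)
HB.mixin Record VectorLattice_isAlgebra (R : numDomainType) V
    & VectorLattice R V := {
  vmul : V -> V -> V ;
  vmulA : associative vmul ;
  vmulDl : left_distributive vmul +%R ;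
  vmulDr : right_distributive vmul +%R ;
  vmulZl : forall (a : R) (x y : V), vmul (a *: x) y = a *: vmul x y ;
  vmulZr : forall (a : R) (x y : V), vmul x (a *: y) = a *: vmul x y ;
  vmul_ge0 : forall x y : V, 0 <=v x -> 0 <=v y -> 0 <=v vmul x y
}.

#[short(type="vectorLatticeAlgType")]
HB.structure Definition VectorLatticeAlgebra (R : numDomainType) :=
  {V of VectorLattice R V & VectorLattice_isAlgebra R V}.

HB.mixin Record VectorLatticeAlgebra_isFAlgebra (R : numDomainType) V
    & VectorLatticeAlgebra R V := {
  falg_mull : forall a b c : V, vmeet a b = 0 -> 0 <=v c ->
    vmeet (vmul a c) b = 0 ;
  falg_mulr : forall a b c : V, vmeet a b = 0 -> 0 <=v c ->
    vmeet (vmul c a) b = 0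
}.

#[short(type="fAlgType")]
HB.structure Definition FAlgebra (R : numDomainType) :=
  {V of VectorLatticeAlgebra R V & VectorLatticeAlgebra_isFAlgebra R V}.

Definition vabs (R : numDomainType) (V : vectorLatticeType R) (x : V) : V :=
  vjoin x (- x).

HB.mixin Record isSubmultiplicativeLatticeNormed (R : realType) V
    & FAlgebra R V & CompleteNormedModule R V := {
  ler_vnorm : forall x y : V, vabs x <=v vabs y -> `|x| <= `|y| ;
  ler_vnormM : forall x y : V, `|vmul x y| <= `|x| * `|y|
}.

#[short(type="banachFAlgType")]
HB.structure Definition BanachFAlgebra (R : realType) :=
  {V of FAlgebra R V & CompleteNormedModule R V
      & isSubmultiplicativeLatticeNormed R V}.

Record lattice_algebra_hom (R : numDomainType) (A B : vectorLatticeAlgType R)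
    (f : A -> B) : Prop := LatticeAlgebraHom {
  lahom_linear : linear f ;
  lahom_meet : {morph f : x y / vmeet x y} ;
  lahom_join : {morph f : x y / vjoin x y} ;
  lahom_mul : {morph f : x y / vmul x y}
}.

Definition lattice_algebra_iso (R : numDomainType)
    (A B : vectorLatticeAlgType R) (f : A -> B) : Prop :=
  lattice_algebra_hom f /\ bijective f.

(* The operator norm of a linear map, equal to +oo if the map is unbounded. *)
Definition opnorm (R : realType) (E F : normedModType R) (T : E -> F) : \bar R :=
  ereal_sup [set `|T x|%:E | x in [set x : E | `|x| <= 1]].

Definition contractive (R : realType) (E F : normedModType R) (T : E -> F) :=
  (opnorm T <= 1)%E.

(* The extension of T is unique among all lattice-algebra homomorphisms that
   extend T, not only among those of norm opnorm T.  With the weaker reading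
   every Banach f-algebra would be free over the zero space. *)
Record is_free_banach_falgebra (R : realType) (E : completeNormedModType R)
    (F : banachFAlgType R) (eta : E -> F) : Prop := IsFreeBanachFAlgebra {
  free_linear : linear eta ;
  free_isometry : forall x, `|eta x| = `|x| ;
  free_universal : forall (A : banachFAlgType R) (T : E -> A),
    linear T -> contractive T ->
    exists2 That : F -> A,
      [/\ lattice_algebra_hom That, That \o eta = T & opnorm That = opnorm T] &
      forall S : F -> A, lattice_algebra_hom S -> S \o eta = T -> S = That
}.

Definition finite_dimensional (R : realType) (E : lmodType R) : Prop :=
  exists n, exists2 f : E -> 'rV[R]_n, linear f & bijective f.

Section dual_space.
Context {R : realType} (E : normedModType R).

Record dual := Dual {
  dual_fun :> E -> R ;
  dual_linear : linear dual_fun ;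
  dual_continuous : continuous dual_fun
}.

HB.instance Definition _ (u : dual) :=
  GRing.isLinear.Build R E R _ (dual_fun u) (dual_linear u).

HB.instance Definition _ := gen_eqMixin dual.
HB.instance Definition _ := gen_choiceMixin dual.

Lemma dual_ext (u v : dual) : u =1 v -> u = v.
Proof.
case: u v => [u lu cu] [v lv cv] /= /funext uv.
by case: v / uv in lv cv *; congr Dual; exact: Prop_irrelevance.
Qed.

Fact dual0_linear : linear (fun _ : E => 0 : R).
Proof. by move=> a x y; rewrite scaler0 addr0. Qed.

Fact dual0_continuous : continuous (fun _ : E => 0 : R).
Proof. by move=> x; exact: cvg_cst. Qed.

Definition dual0 := Dual dual0_linear dual0_continuous.

Fact dualD_linear (u v : dual) : linear (fun x => u x + v x).
Proof. by move=> a x y; rewrite !dual_linear scalerDr addrACA. Qed.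

Fact dualD_continuous (u v : dual) : continuous (fun x => u x + v x).
Proof. by move=> x; apply: cvgD; exact: dual_continuous. Qed.

Definition dualD u v := Dual (@dualD_linear u v) (@dualD_continuous u v).

Fact dualN_linear (u : dual) : linear (fun x => - u x).
Proof. by move=> a x y; rewrite !dual_linear opprD scalerN. Qed.

Fact dualN_continuous (u : dual) : continuous (fun x => - u x).
Proof. by move=> x; apply: cvgN; exact: dual_continuous. Qed.

Definition dualN u := Dual (@dualN_linear u) (@dualN_continuous u).

Fact dualZ_linear (a : R) (u : dual) : linear (fun x => a * u x).
Proof.
by move=> b x y; rewrite !dual_linear mulrDr; congr (_ + _); exact: mulrCA.
Qed.

Fact dualZ_continuous (a : R) (u : dual) : continuous (fun x => a * u x).
Proof. by move=> x; apply: cvgMr; exact: dual_continuous. Qed.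

Definition dualZ a u := Dual (@dualZ_linear a u) (@dualZ_continuous a u).

Fact dual_addA : associative dualD.
Proof. by move=> u v w; apply: dual_ext => x /=; rewrite addrA. Qed.
Fact dual_addC : commutative dualD.
Proof. by move=> u v; apply: dual_ext => x /=; rewrite addrC. Qed.
Fact dual_add0 : left_id dual0 dualD.
Proof. by move=> u; apply: dual_ext => x /=; rewrite add0r. Qed.
Fact dual_addN : left_inverse dual0 dualN dualD.
Proof. by move=> u; apply: dual_ext => x /=; rewrite addNr. Qed.

HB.instance Definition _ :=
  GRing.isZmodule.Build dual dual_addA dual_addC dual_add0 dual_addN.

Fact dual_scaleA a b u : dualZ a (dualZ b u) = dualZ (a * b) u.
Proof. by apply: dual_ext => x /=; rewrite mulrA. Qed.
Fact dual_scale1 : left_id 1 dualZ.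
Proof. by move=> u; apply: dual_ext => x /=; rewrite mul1r. Qed.
Fact dual_scaleDr : right_distributive dualZ +%R.
Proof. by move=> a u v; apply: dual_ext => x /=; rewrite mulrDr. Qed.
Fact dual_scaleDl u : {morph dualZ^~ u : a b / a + b}.
Proof. by move=> a b; apply: dual_ext => x /=; rewrite mulrDl. Qed.

HB.instance Definition _ := GRing.Zmodule_isLmodule.Build R dual
  dual_scaleA dual_scale1 dual_scaleDr dual_scaleDl.

Definition dual_norm (u : dual) : R := fine (opnorm u).

Lemma dual_opnorm_fin_num (u : dual) : opnorm u \is a fin_num.
Proof.
have /linear_boundedP[M [_ MU]] : bounded_near u (nbhs (0 : E)).
  by apply/linear_bounded_continuous; exact: dual_continuous.
rewrite ge0_fin_numE.
  apply: (@le_lt_trans _ _ (`|M| + 1)%:E); last exact: ltry.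
  apply: ge_ereal_sup => _ [x /= x1 <-]; rewrite lee_fin.
  have := MU (`|M| + 1); rewrite (le_lt_trans (ler_norm _)) ?ltrDl//.
  move=> /(_ erefl x) /le_trans; apply.
  by rewrite ler_piMr// addr_ge0.
by apply: ereal_sup_ubound; exists 0; rewrite /= ?normr0 ?linear0 ?normr0.
Qed.

Lemma dual_norm_ub (u : dual) x : `|x| <= 1 -> `|u x| <= dual_norm u.
Proof.
move=> x1; rewrite -lee_fin /dual_norm fineK ?dual_opnorm_fin_num//.
by apply: ereal_sup_ubound; exists x.
Qed.

Lemma dual_norm_le (u : dual) M :
  (forall x, `|x| <= 1 -> `|u x| <= M) -> dual_norm u <= M.
Proof.
move=> uM; rewrite -lee_fin /dual_norm fineK ?dual_opnorm_fin_num//.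
by apply: ge_ereal_sup => _ [x /= x1 <-]; rewrite lee_fin uM.
Qed.

Fact dual_normD (u v : dual) : dual_norm (u + v) <= dual_norm u + dual_norm v.
Proof.
apply: dual_norm_le => x x1; apply: (le_trans (ler_normD _ _)).
by apply: lerD; exact: dual_norm_ub.
Qed.

Fact dual_normZ (a : R) (u : dual) : dual_norm (a *: u) = `|a| * dual_norm u.
Proof.
have le b v : dual_norm (b *: v) <= `|b| * dual_norm v.
  by apply: dual_norm_le => x x1; rewrite /= normrM ler_wpM2l// dual_norm_ub.
apply/eqP; rewrite eq_le le /=.
have [->|a0] := eqVneq a 0.
  rewrite normr0 mul0r; apply: le_trans (@dual_norm_ub _ 0 _) => //.
  by rewrite normr0.
rewrite -ler_pdivlMl ?normr_gt0// -normfV.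
by apply: le_trans (le _ _); rewrite scalerA mulVf// scale1r.
Qed.

Fact dual_norm_eq0 (u : dual) : dual_norm u = 0 -> u = 0.
Proof.
move=> u0; apply: dual_ext => x /=.
have [->|x0] := eqVneq x 0; first exact: linear0.
have nx0 : `|x| != 0 by rewrite normr_eq0.
have : `|u (`|x|^-1 *: x)| <= 0.
  by rewrite -u0 dual_norm_ub// normrZ normfV normr_id mulVf.
rewrite normr_le0 => /eqP /(congr1 ( *%R `|x|)).
by rewrite linearZ/= -[_ *: _]/(_ * _) mulrA mulfV// mul1r mulr0.
Qed.

HB.instance Definition _ := Lmodule_isNormed.Build R dual
  dual_normD dual_normZ dual_norm_eq0.

End dual_space.

Section continuous_functions.
Context {R : realType} {X : topologicalType}.

Notation C := (continuousType X R).

Let cts0 : continuous (fun _ : X => 0 : R).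
Proof. by move=> x; exact: cvg_cst. Qed.
Let ctsD (f g : C) : continuous (fun x => f x + g x).
Proof. by move=> x; apply: cvgD; exact: cts_fun. Qed.
Let ctsN (f : C) : continuous (fun x => - f x).
Proof. by move=> x; apply: cvgN; exact: cts_fun. Qed.
Let ctsZ (a : R) (f : C) : continuous (fun x => a * f x).
Proof. by move=> x; apply: cvgMr; exact: cts_fun. Qed.
Let cts_min (f g : C) : continuous (fun x => Num.min (f x) (g x)).
Proof. by move=> x; apply: continuous_min; exact: cts_fun. Qed.
Let cts_max (f g : C) : continuous (fun x => Num.max (f x) (g x)).
Proof. by move=> x; apply: continuous_max; exact: cts_fun. Qed.

Definition cfun0 : C := mkcts cts0.
Definition cfun_add (f g : C) : C := mkcts (@ctsD f g).
Definition cfun_opp (f : C) : C := mkcts (@ctsN f).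
Definition cfun_scale (a : R) (f : C) : C := mkcts (@ctsZ a f).
Definition cfun_le (f g : C) : bool := `[< forall x, f x <= g x >].
Definition cfun_min (f g : C) : C := mkcts (@cts_min f g).
Definition cfun_max (f g : C) : C := mkcts (@cts_max f g).

Fact cfun_addA : associative cfun_add.
Proof. by move=> f g h; apply/continuousEP => x; exact: addrA. Qed.
Fact cfun_addC : commutative cfun_add.
Proof. by move=> f g; apply/continuousEP => x; exact: addrC. Qed.
Fact cfun_add0 : left_id cfun0 cfun_add.
Proof. by move=> f; apply/continuousEP => x; exact: add0r. Qed.
Fact cfun_addN : left_inverse cfun0 cfun_opp cfun_add.
Proof. by move=> f; apply/continuousEP => x; exact: addNr. Qed.

HB.instance Definition _ :=
  GRing.isZmodule.Build C cfun_addA cfun_addC cfun_add0 cfun_addN.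

Fact cfun_scaleA a b f :
  cfun_scale a (cfun_scale b f) = cfun_scale (a * b) f.
Proof. by apply/continuousEP => x; exact: mulrA. Qed.
Fact cfun_scale1 : left_id 1 cfun_scale.
Proof. by move=> f; apply/continuousEP => x; exact: mul1r. Qed.
Fact cfun_scaleDr : right_distributive cfun_scale +%R.
Proof. by move=> a f g; apply/continuousEP => x; exact: mulrDr. Qed.
Fact cfun_scaleDl f : {morph cfun_scale^~ f : a b / a + b}.
Proof. by move=> a b; apply/continuousEP => x; exact: mulrDl. Qed.

HB.instance Definition _ := GRing.Zmodule_isLmodule.Build R C
  cfun_scaleA cfun_scale1 cfun_scaleDr cfun_scaleDl.

Fact cfun_le_refl : reflexive cfun_le.
Proof. by move=> f; apply/asboolP. Qed.
Fact cfun_le_anti : antisymmetric cfun_le.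
Proof.
move=> f g /andP[/asboolP fg /asboolP gf]; apply/continuousEP => x.
by apply/eqP; rewrite eq_le fg gf.
Qed.
Fact cfun_le_trans : transitive cfun_le.
Proof.
move=> g f h /asboolP fg /asboolP gh; apply/asboolP => x.
exact: le_trans (fg x) (gh x).
Qed.
Fact cfun_le_min f g h : cfun_le f (cfun_min g h) = cfun_le f g && cfun_le f h.
Proof.
apply/asboolP/andP => [fgh|[/asboolP fg /asboolP fh] x].
  by split; apply/asboolP => x; have := fgh x; rewrite /= le_min => /andP[].
by rewrite /= le_min fg fh.
Qed.
Fact cfun_max_le f g h : cfun_le (cfun_max f g) h = cfun_le f h && cfun_le g h.
Proof.
apply/asboolP/andP => [fgh|[/asboolP fh /asboolP gh] x].
  by split; apply/asboolP => x; have := fgh x; rewrite /= ge_max => /andP[].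
by rewrite /= ge_max fh gh.
Qed.
Fact cfun_le_addr (h f g : C) : cfun_le f g -> cfun_le (f + h) (g + h).
Proof. by move=> /asboolP fg; apply/asboolP => x; exact: lerD. Qed.
Fact cfun_le_scale (a : R) (f : C) :
  0 <= a -> cfun_le 0 f -> cfun_le 0 (a *: f).
Proof.
by move=> a0 /asboolP f0; apply/asboolP => x; exact: (mulr_ge0 a0 (f0 x)).
Qed.

HB.instance Definition _ := isVectorLattice.Build R C
  cfun_le_refl cfun_le_anti cfun_le_trans cfun_le_min cfun_max_le
  cfun_le_addr cfun_le_scale.

End continuous_functions.

Definition unit_interval (R : realType) := set_type (`[0, 1]%classic : set R).

Definition dual_sphere (R : realType) (E : normedModType R) :=
  set_type [set u : dual E | `|u| = 1].

Definition dual_cylinder (R : realType) (E : normedModType R) :=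
  (unit_interval R * dual_sphere E)%type.

(* An alias of continuousType, on which the product is the one weighted by the
   first coordinate. *)
Definition weightedC (R : realType) (E : normedModType R) : Type :=
  continuousType (dual_cylinder E) R.

Section weighted_product.
Context {R : realType} {E : normedModType R}.

Notation W := (weightedC E).

HB.instance Definition _ := VectorLattice.on W.

Fact wmul_continuous (f g : W) :
  continuous (fun p : dual_cylinder E => \val p.1 * f p * g p).
Proof.
move=> p; apply: cvgM; last exact: (@cts_fun _ _ (g : continuousType _ _)).
apply: cvgM; last exact: (@cts_fun _ _ (f : continuousType _ _)).
apply: (cvg_comp _ _ (@cvg_fst _ _ _ _ _)).
exact: (@initial_continuous _ _ set_val).
Qed.

Definition wmul (f g : W) : W :=
  (mkcts (@wmul_continuous f g) : continuousType _ _).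

Lemma weightedC_ext (f g : W) : f =1 g -> f = g.
Proof. by move=> fg; apply/continuousEP. Qed.

Lemma wmulE (f g : W) p : wmul f g p = \val p.1 * f p * g p.
Proof. by []. Qed.

Lemma weightedC_addE (f g : W) p : (f + g) p = f p + g p.
Proof. by []. Qed.

Lemma weightedC_scaleE (a : R) (f : W) p : (a *: f) p = a * f p.
Proof. by []. Qed.

Fact wmulA : associative wmul.
Proof.
move=> f g h; apply: weightedC_ext => p; rewrite !wmulE.
by rewrite -!mulrA; congr (_ * _); rewrite mulrCA.
Qed.

Fact wmulDl : left_distributive wmul +%R.
Proof.
move=> f g h; apply: weightedC_ext => p.
by rewrite weightedC_addE !wmulE weightedC_addE mulrDr mulrDl.
Qed.

Fact wmulDr : right_distributive wmul +%R.
Proof.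
move=> f g h; apply: weightedC_ext => p.
by rewrite weightedC_addE !wmulE weightedC_addE mulrDr.
Qed.

Fact wmulZl (a : R) (f g : W) : wmul (a *: f) g = a *: wmul f g.
Proof.
apply: weightedC_ext => p.
by rewrite weightedC_scaleE !wmulE weightedC_scaleE mulrCA -!mulrA.
Qed.

Fact wmulZr (a : R) (f g : W) : wmul f (a *: g) = a *: wmul f g.
Proof.
apply: weightedC_ext => p.
by rewrite weightedC_scaleE !wmulE weightedC_scaleE mulrCA.
Qed.

Fact wmul_ge0 (f g : W) : 0 <=v f -> 0 <=v g -> 0 <=v wmul f g.
Proof.
move=> /asboolP f0 /asboolP g0; apply/asboolP => p.
have /set_mem := valP p.1; rewrite /= in_itv /= => /andP[p0 _].
exact: (mulr_ge0 (mulr_ge0 p0 (f0 p)) (g0 p)).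
Qed.

HB.instance Definition _ := VectorLattice_isAlgebra.Build R W
  wmulA wmulDl wmulDr wmulZl wmulZr wmul_ge0.

End weighted_product.

(* Main.v *)
Require Import Defs.
From HB Require Import structures.
From mathcomp Require Import all_boot all_order all_algebra.
From mathcomp Require Import all_classical all_reals all_analysis.
From mathcomp Require Import ring lra.

Set Implicit Arguments.
Unset Strict Implicit.
Unset Printing Implicit Defensive.

Import Order.TTheory GRing.Theory Num.Theory.
Import numFieldNormedType.Exports.

Local Open Scope classical_set_scope.
Local Open Scope ring_scope.

(** Write A for the free Banach f-algebra, X for the cylinder of pairs (r, u)
    and W for the weighted algebra C(X).  Since r <= 1, W with the supremum
    norm is itself a Banach f-algebra, and x |-> ((r, u) |-> u x) is
    contractive, so freeness gives a homomorphism Phi : A -> W with the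
    required values on eta.  The point is that Phi is bijective.

    The first ingredient is an inequality special to Banach f-algebras: a
    positive element a satisfies a y <= |a| y for all y >= 0 (vmul_le).  Let e
    be the sum of the absolute values of the images of a basis of E.  By that
    inequality the ideal I of elements dominated by multiples of e is a
    subalgebra, and it contains eta.

    The second ingredient is that I has enough real lattice homomorphisms
    (exists_state_gt0): an element that is not <= 0 is positive at one of them.
    Such an f with f e = 1 satisfies f (x y) = f x * f y * f (e e) (state_mul),
    because multiplications preserve bands and therefore the kernel of f.  So f
    is determined on everything generated by E by the functional f \o eta and
    by the weight f (e e); normalizing the functional to norm 1 turns these
    data into a point (r, u), and vmul_le gives r <= 1.  Up to a positive
    factor f is thus the evaluation of Phi at a point of X.

    Hence on the elements represented in this way, which include everything
    obtained from E by the algebraic and lattice operations and by e-uniform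
    limits, a <= 0 as soon as Phi a <= 0.  Their images separate the points of
    X suitably for the lattice form of the Stone-Weierstrass theorem
    (lattice_dense), and since Phi e is bounded away from 0 the comparison
    above turns uniformly convergent images into norm convergent preimages.  So
    Phi maps the represented elements bijectively onto W, and the inverse Psi
    is a homomorphism W -> A with Psi (Phi (eta x)) = eta x
    (exists_section_hom).  By the uniqueness part of freeness Psi \o Phi is the
    identity. *)

Arguments vle_trans {R s} [y x z] _ _.
Arguments vle_scale {R s} [a x] _ _.
Arguments vle_addr {R s} z [x y] _.
Arguments falg_mull {R s} [a b c] _ _.
Arguments falg_mulr {R s} [a b c] _ _.
Arguments vmul_ge0 {R s} [x y] _ _.

(** * Arithmetic in vector lattices *)

Section vector_lattice.
Context {R : realFieldType} {V : vectorLatticeType R}.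
Implicit Types (x y z p q : V) (a b : R).

Lemma vle_add2r z x y : (x + z <=v y + z) = (x <=v y).
Proof.
apply/idP/idP => [|xy]; last exact: vle_addr.
by move/(vle_addr (- z)); rewrite !addrK.
Qed.

Lemma vsubr_ge0 x y : (0 <=v y - x) = (x <=v y).
Proof. by rewrite -(vle_add2r x) add0r subrK. Qed.

Lemma vsubr_le0 x y : (x - y <=v 0) = (x <=v y).
Proof. by rewrite -(vle_add2r y) add0r subrK. Qed.

Lemma vleN2 x y : (- x <=v - y) = (y <=v x).
Proof. by rewrite -vsubr_ge0 opprK addrC vsubr_ge0. Qed.

Lemma vleD x y z t : x <=v y -> z <=v t -> x + z <=v y + t.
Proof.
move=> xy zt; apply: (@vle_trans _ _ (y + z)); first by rewrite vle_add2r.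
by rewrite ![y + _]addrC vle_add2r.
Qed.

Lemma vleZ a x y : 0 <= a -> x <=v y -> a *: x <=v a *: y.
Proof.
by move=> a0; rewrite -vsubr_ge0 => /(vle_scale a0); rewrite scalerBr vsubr_ge0.
Qed.

Lemma vle_pZ a x y : 0 < a -> (a *: x <=v a *: y) = (x <=v y).
Proof.
move=> a0; apply/idP/idP; last exact/vleZ/ltW.
move=> /(@vleZ a^-1); rewrite invr_ge0 ltW// => /(_ isT).
by rewrite !scalerA mulVf ?gt_eqF// !scale1r.
Qed.

Lemma vle_pdivl a x y : 0 < a -> (a^-1 *: x <=v y) = (x <=v a *: y).
Proof.
by move=> a0; rewrite -(vle_pZ _ _ a0) scalerA mulfV ?gt_eqF// scale1r.
Qed.

Lemma vle_wZ a b x : 0 <=v x -> a <= b -> a *: x <=v b *: x.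
Proof.
by move=> x0 ab; rewrite -vsubr_ge0 -scalerBl vle_scale// subr_ge0.
Qed.

Lemma vaddr_ge0 x y : 0 <=v x -> 0 <=v y -> 0 <=v x + y.
Proof. by move=> x0 y0; rewrite -[0]addr0 vleD. Qed.

Lemma vleDl x y : 0 <=v y -> x <=v x + y.
Proof. by move=> y0; rewrite -{1}[x]addr0 vleD// vle_refl. Qed.

Lemma vle_eq x y : x <=v y -> y <=v x -> x = y.
Proof. by move=> xy yx; apply: vle_anti; rewrite xy. Qed.

Lemma vmeet_lel x y : vmeet x y <=v x.
Proof. by have := vle_refl (vmeet x y); rewrite vle_meet => /andP[]. Qed.

Lemma vmeet_ler x y : vmeet x y <=v y.
Proof. by have := vle_refl (vmeet x y); rewrite vle_meet => /andP[]. Qed.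

Lemma vle_joinl x y : x <=v vjoin x y.
Proof. by have := vle_refl (vjoin x y); rewrite vjoin_le => /andP[]. Qed.

Lemma vle_joinr x y : y <=v vjoin x y.
Proof. by have := vle_refl (vjoin x y); rewrite vjoin_le => /andP[]. Qed.

Lemma vmeetC x y : vmeet x y = vmeet y x.
Proof. by apply: vle_eq; rewrite vle_meet vmeet_lel vmeet_ler. Qed.

Lemma vmeet_idPl x y : x <=v y -> vmeet x y = x.
Proof. by move=> xy; apply: vle_eq; rewrite ?vmeet_lel// vle_meet vle_refl. Qed.

Lemma vjoin_idPl x y : y <=v x -> vjoin x y = x.
Proof. by move=> xy; apply: vle_eq; rewrite ?vle_joinl// vjoin_le vle_refl. Qed.

Lemma vjoinDr z x y : vjoin x y + z = vjoin (x + z) (y + z).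
Proof.
have le z' x' y' : vjoin (x' + z') (y' + z') <=v vjoin x' y' + z'.
  by rewrite vjoin_le !vle_add2r vle_joinl vle_joinr.
apply: vle_eq; last exact: le.
by have := le (- z) (x + z) (y + z); rewrite !addrK -(vle_add2r z) subrK.
Qed.

Lemma vmeetDr z x y : vmeet x y + z = vmeet (x + z) (y + z).
Proof.
have le z' x' y' : vmeet x' y' + z' <=v vmeet (x' + z') (y' + z').
  by rewrite vle_meet !vle_add2r vmeet_lel vmeet_ler.
apply: vle_eq; first exact: le.
by have := le (- z) (x + z) (y + z); rewrite !addrK -(vle_add2r z) subrK.
Qed.

Lemma oppr_vjoin x y : - vjoin x y = vmeet (- x) (- y).
Proof.
apply: vle_eq; first by rewrite vle_meet !vleN2 vle_joinl vle_joinr.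
rewrite -[X in X <=v _]opprK vleN2 vjoin_le.
by rewrite -[X in X <=v _]opprK vleN2 vmeet_lel -[X in X <=v _]opprK vleN2
  vmeet_ler.
Qed.

Lemma oppr_vmeet x y : - vmeet x y = vjoin (- x) (- y).
Proof. by apply: oppr_inj; rewrite opprK oppr_vjoin !opprK. Qed.

Definition vpos x := vjoin x 0.

Lemma vpos_ge0 x : 0 <=v vpos x.
Proof. exact: vle_joinr. Qed.

Lemma vle_vpos x : x <=v vpos x.
Proof. exact: vle_joinl. Qed.

Lemma vpos_le x y : 0 <=v y -> x <=v y -> vpos x <=v y.
Proof. by move=> y0 xy; rewrite vjoin_le xy. Qed.

Lemma vposE x : vpos x = x + vpos (- x).
Proof. by rewrite addrC vjoinDr addNr add0r /vpos; apply: vle_eq;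
  rewrite vjoin_le vle_joinl vle_joinr. Qed.

Lemma vpos_sub x : vpos x - vpos (- x) = x.
Proof. by rewrite vposE addrK. Qed.

Lemma vpos_disj x : vmeet (vpos x) (vpos (- x)) = 0.
Proof.
rewrite {1}vposE -{2}[vpos _]add0r -vmeetDr -[vmeet _ _]opprK oppr_vmeet oppr0.
exact: addNr.
Qed.

Lemma vpos_eq0 x : vpos x = 0 -> x <=v 0.
Proof. by move=> <-; exact: vle_vpos. Qed.

Lemma vdisj_le x y x' y' : 0 <=v x' -> 0 <=v y' -> x' <=v x -> y' <=v y ->
  vmeet x y = 0 -> vmeet x' y' = 0.
Proof.
move=> x0 y0 xx yy xy; apply: vle_eq; last by rewrite vle_meet x0.
rewrite -xy vle_meet (vle_trans (vmeet_lel _ _) xx).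
exact: vle_trans (vmeet_ler _ _) yy.
Qed.

Lemma vdisj_addl x p q : 0 <=v q -> vmeet x p = 0 -> x <=v p + q -> x <=v q.
Proof.
move=> q0 xp xpq; rewrite -vsubr_le0 -xp vle_meet; apply/andP; split.
  by rewrite -(vle_add2r q) subrK vleDl.
by rewrite -(vle_add2r q) subrK.
Qed.

Lemma vdisjZ a x y : 0 <= a -> vmeet x y = 0 -> vmeet (a *: x) y = 0.
Proof.
move=> a0 xy; have x0 : 0 <=v x by rewrite -xy vmeet_lel.
have y0 : 0 <=v y by rewrite -xy vmeet_ler.
apply: vle_eq; last by rewrite vle_meet y0 vle_scale.
have a1 : 0 < a + 1 by rewrite ltr_wpDl.
have ax : a *: x <=v (a + 1) *: x by rewrite vle_wZ// lerDl.
have yay : y <=v (a + 1) *: y by rewrite -{1}[y]scale1r vle_wZ// lerDr.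
rewrite -(@vle_pZ (a + 1)^-1) ?invr_gt0// scaler0 -xy vle_meet !vle_pdivl//.
by rewrite (vle_trans (vmeet_lel _ _) ax) (vle_trans (vmeet_ler _ _) yay).
Qed.

Lemma vabs_ge x : x <=v vabs x. Proof. exact: vle_joinl. Qed.

Lemma vabs_geN x : - x <=v vabs x. Proof. exact: vle_joinr. Qed.

Lemma vabs_ge0 x : 0 <=v vabs x.
Proof.
rewrite -(@vle_pZ 2%:R)// scaler0 scaler_nat mulr2n -(subrr x).
by rewrite vleD ?vabs_ge ?vabs_geN.
Qed.

Lemma vabs_le x y : x <=v y -> - x <=v y -> vabs x <=v y.
Proof. by move=> xy nxy; rewrite vjoin_le xy. Qed.

Lemma vabs_id x : 0 <=v x -> vabs x = x.
Proof.
move=> x0; apply: vjoin_idPl; apply: vle_trans (x0).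
by rewrite -vleN2 opprK oppr0.
Qed.

End vector_lattice.

(** * Band preserving operators and multiplications in a Banach f-algebra *)

(** The positive band preserving operators.  Left and right multiplications by
    a positive element of an f-algebra are both of this kind, so that one
    argument about them serves for the two sides. *)
Record orthomorphism (R : numDomainType) (V : vectorLatticeType R)
    (p : V -> V) : Prop := Orthomorphism {
  ortho_linear : linear p ;
  ortho_ge0 : forall x, 0 <=v x -> 0 <=v p x ;
  ortho_disj : forall x y, vmeet x y = 0 -> vmeet (p x) y = 0
}.

Section linear_facts.
Context {R : pzRingType} {U V : lmodType R} (f : U -> V).
Hypothesis fl : linear f.

Lemma linear_fun0 : f 0 = 0.
Proof. by rewrite -[0](addNr 0) -[- 0]scaleN1r fl scaleN1r addNr. Qed.

Lemma linear_funD x y : f (x + y) = f x + f y.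
Proof. by rewrite -{1}[x]scale1r fl scale1r. Qed.

Lemma linear_funZ a x : f (a *: x) = a *: f x.
Proof. by rewrite -{1}[_ *: x]addr0 fl linear_fun0 addr0. Qed.

Lemma linear_funN x : f (- x) = - f x.
Proof. by rewrite -scaleN1r linear_funZ scaleN1r. Qed.

Lemma linear_funB x y : f (x - y) = f x - f y.
Proof. by rewrite linear_funD linear_funN. Qed.

Lemma linear_fun_sum I (r : seq I) (P : pred I) F :
  f (\sum_(i <- r | P i) F i) = \sum_(i <- r | P i) f (F i).
Proof.
by elim/big_rec2: _ => [|i y x _ <-]; [exact: linear_fun0|exact: linear_funD].
Qed.

End linear_facts.

Section multiplications.
Context {R : realFieldType} {A : vectorLatticeAlgType R}.
Implicit Types x y c : A.

Lemma vmull_linear c : linear (vmul c).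
Proof. by move=> a x y; rewrite vmulDr vmulZr. Qed.

Lemma vmulr_linear c : linear (fun x => vmul x c).
Proof. by move=> a x y; rewrite vmulDl vmulZl. Qed.

End multiplications.

Section falgebra.
Context {R : realFieldType} {A : fAlgType R}.
Implicit Types x y c : A.

Lemma ortho_vmull c : 0 <=v c -> orthomorphism (vmul c).
Proof.
move=> c0; split; first exact: vmull_linear.
- by move=> x; exact: vmul_ge0.
- by move=> x y /falg_mulr; exact.
Qed.

Lemma ortho_vmulr c : 0 <=v c -> orthomorphism (fun x => vmul x c).
Proof.
move=> c0; split; first exact: vmulr_linear.
- by move=> x x0; exact: vmul_ge0.
- by move=> x y /falg_mull; exact.
Qed.

Lemma vdisj_mul x y : vmeet x y = 0 -> vmul x y = 0.
Proof.
move=> xy; have x0 : 0 <=v x by rewrite -xy vmeet_lel.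
have y0 : 0 <=v y by rewrite -xy vmeet_ler.
rewrite -[vmul x y](vmeet_idPl (vle_refl _)).
by apply: falg_mulr => //; rewrite vmeetC; exact: falg_mull.
Qed.

End falgebra.

Section orthomorphism_monotone.
Context {R : realFieldType} {V : vectorLatticeType R} (p : V -> V).
Hypothesis po : orthomorphism p.

Lemma ortho_mono x y : x <=v y -> p x <=v p y.
Proof.
rewrite -vsubr_ge0 => /(ortho_ge0 po).
by rewrite (linear_funB (ortho_linear po)) vsubr_ge0.
Qed.

End orthomorphism_monotone.

Section banach_falgebra.
Context {R : realType} {A : banachFAlgType R}.
Implicit Types x y z a b c : A.

Lemma vnorm_le x y : 0 <=v x -> x <=v y -> `|x| <= `|y|.
Proof.
move=> x0 xy; apply: ler_vnorm; rewrite !vabs_id//; exact: vle_trans xy.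
Qed.

Lemma vnorm_abs x : `|vabs x| = `|x|.
Proof.
by apply/eqP; rewrite eq_le !ler_vnorm// ?[vabs (vabs _)]vabs_id ?vabs_ge0
  ?vle_refl.
Qed.

(** The positive cone of a normed lattice is closed: if x exceeds y by
    arbitrarily small errors only, the positive part of x - y has norm 0. *)
Lemma vle_closed x y :
  (forall d : R, 0 < d -> exists2 z, `|z| <= d & x <=v y + z) -> x <=v y.
Proof.
move=> xy; rewrite -vsubr_le0; apply: vpos_eq0; apply/eqP.
rewrite -normr_le0; apply/ler_addgt0Pr => d /xy[z zd xyz].
rewrite add0r (le_trans _ zd)// -(vnorm_abs z) vnorm_le ?vpos_ge0//.
apply: vpos_le; first exact: vabs_ge0.
by apply: vle_trans (vabs_ge z); rewrite -(vle_add2r y) subrK addrC.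
Qed.

Lemma vle_archi x y : (forall t : R, 0 < t -> x <=v t *: y) -> x <=v 0.
Proof.
move=> xy; apply: vle_closed => d d0.
have y0 : 0 < `|y| + 1 by rewrite ltr_wpDl.
exists ((d / (`|y| + 1)) *: y); rewrite ?add0r ?xy ?divr_gt0//.
rewrite normrZ gtr0_norm ?divr_gt0// mulrAC ler_pdivrMr// ler_wpM2l ?(ltW d0)//.
by rewrite lerDl.
Qed.

(** Split z along t b: where z exceeds t b the element b contributes nothing
    to p b, because p kills the part of b below a multiple of z. *)
Lemma ortho_ker_disj (p : A -> A) z b : orthomorphism p ->
  0 <=v z -> 0 <=v b -> p z = 0 -> vmeet (p b) z = 0.
Proof.
move=> po z0 b0 pz; have pl := ortho_linear po.
apply: vle_eq; last by rewrite vle_meet z0 ortho_ge0.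
apply: (@vle_archi _ b) => t t0.
have : t *: p b <=v p (vpos (t *: b - z)).
  rewrite -(linear_funZ pl) -[p (vpos _)]addr0 -pz -(linear_funD pl).
  by apply: ortho_mono => //; rewrite -(vle_add2r (- z)) addrK vle_vpos.
move=> /vdisj_le /(_ (vle_refl (vpos (- (t *: b - z))))).
rewrite !vpos_ge0 vle_scale ?ortho_ge0 ?ltW// => /(_ isT isT).
move=> /(_ (ortho_disj po (vpos_disj _))).
have t'0 : 0 <= t^-1 by rewrite invr_ge0 ltW.
move=> /(vdisjZ t'0); rewrite scalerA mulVf ?gt_eqF// scale1r => dj.
have bt0 : 0 <=v t *: b by rewrite vle_scale// ltW.
apply: (@vdisj_addl _ _ _ (vpos (- (t *: b - z)))) => //.
  apply: vdisj_le dj; rewrite ?vpos_ge0 ?vle_refl ?vmeet_lel//.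
  by rewrite vle_meet z0 ortho_ge0.
apply: vle_trans (vmeet_ler _ _) _.
by rewrite -(vle_add2r (- (t *: b))) addrK opprB vle_vpos.
Qed.

(** Let z and w be the positive and negative parts of a y - y.  As w z = 0,
    multiplying by z gives y z <= a y z, and comparing norms y z = 0, whence
    z z = 0.  A nilpotent element annihilates everything, so a z = 0, which
    makes z disjoint from a y although z <= a y. *)
Lemma vmul_le_contr a y : 0 <=v a -> 0 <=v y -> `|a| < 1 -> vmul a y <=v y.
Proof.
move=> a0 y0 a1; rewrite -vsubr_le0; apply: vpos_eq0.
set z := vpos _; have z0 : 0 <=v z by exact: vpos_ge0.
have ay0 : 0 <=v vmul a y by exact: vmul_ge0.
have zy : z <=v vmul a y.
  by apply: vpos_le => //; rewrite -(vle_add2r y) subrK vleDl.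
have eqz : vmul a (vmul y z) = vmul y z + vmul z z.
  have := vpos_sub (vmul a y - y); rewrite -/z => /(congr1 (vmul^~ z)).
  rewrite !(linear_funB (vmulr_linear z)) vmulA.
  rewrite [vmul (vpos _) z]vdisj_mul; last by rewrite vmeetC vpos_disj.
  by rewrite subr0 => ->; rewrite addrC subrK.
have yz0 : vmul y z = 0.
  apply/eqP; rewrite -normr_le0 -(pmulr_rle0 _ (_ : 0 < 1 - `|a|)) ?subr_gt0//.
  rewrite mulrBl mul1r subr_le0; apply: le_trans (ler_vnormM _ _).
  by apply: vnorm_le; rewrite ?vmul_ge0// eqz vleDl// vmul_ge0.
have zz0 : vmul z z = 0.
  by have := eqz; rewrite yz0 (linear_fun0 (vmull_linear a)) add0r => <-.
have az0 : vmul a z = 0.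
  have := ortho_ker_disj (ortho_vmulr z0) z0 a0 zz0.
  rewrite vmeetC => /falg_mulr /(_ a0).
  by rewrite (vmeet_idPl (vle_refl _)).
have := ortho_ker_disj (ortho_vmull a0) z0 y0 az0.
by rewrite vmeetC vmeet_idPl.
Qed.

(** Divide a by anything above its norm; the excess disappears because the
    order is Archimedean. *)
Lemma vmul_le a y : 0 <=v a -> 0 <=v y -> vmul a y <=v `|a| *: y.
Proof.
move=> a0 y0; rewrite -vsubr_le0; apply: (@vle_archi _ y) => t t0.
rewrite -(vle_add2r (`|a| *: y)) subrK -scalerDl.
have s0 : 0 < t + `|a| by rewrite ltr_pwDl.
rewrite -(@vle_pZ _ _ (t + `|a|)^-1) ?invr_gt0// scalerA mulVf ?gt_eqF//.
rewrite scale1r -vmulZl vmul_le_contr ?vle_scale ?invr_ge0 ?ltW//.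
by rewrite normrZ gtr0_norm ?invr_gt0// ltr_pdivrMl// mulr1 ltrDr.
Qed.

End banach_falgebra.

(** * Real lattice homomorphisms on principal ideals *)

Section infimum_of_family.
Context {R : realType} {T : Type} (g : T -> R).
Hypothesis g_lb : exists b, forall i, b <= g i.

Lemma inf_range_le i : inf (range g) <= g i.
Proof.
have [b gb] := g_lb; apply: ge_inf; last by exists i.
by exists b => _ [j _ <-].
Qed.

Lemma inf_range_near (i0 : T) d : 0 < d -> exists i, g i < inf (range g) + d.
Proof.
have [b gb] := g_lb => d0; have hi : has_inf (range g).
  by split; [exists (g i0), i0|exists b => _ [j _ <-]].
by have [_ [i _ <-] gi] := inf_adherent d0 hi; exists i.
Qed.

Lemma le_inf_range (i0 : T) b : (forall i, b <= g i) -> b <= inf (range g).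
Proof.
by move=> gb; apply: lb_le_inf => [|_ [j _ <-]]; [exists (g i0), i0|].
Qed.

End infimum_of_family.

Section principal_ideal.
Context {R : realType} {V : vectorLatticeType R} (e : V).

Definition principal_ideal : set V :=
  [set x | exists2 t : R, - (t *: e) <=v x & x <=v t *: e].

Local Notation I := principal_ideal.

Record lattice_state (f : V -> R) : Prop := LatticeState {
  state_linear : forall a x y, I x -> I y -> f (a *: x + y) = a * f x + f y ;
  state_join : forall x y, I x -> I y -> f (vjoin x y) = Num.max (f x) (f y) ;
  state_unit : f e = 1
}.

(** In the representation of the ideal as functions on a compact space, with
    e the constant 1, these are the functions x |-> sup_K x for K a nonempty
    closed set of points; the minimal ones are the points themselves. *)
Record max_functional (p : V -> R) : Prop := MaxFunctional {
  maxf_add : forall x y, I x -> I y -> p (x + y) <= p x + p y ;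
  maxf_scale : forall c x, 0 < c -> I x -> p (c *: x) <= c * p x ;
  maxf_mono : forall x y, I x -> I y -> x <=v y -> p x <= p y ;
  maxf_join : forall x y, I x -> I y -> p (vjoin x y) <= Num.max (p x) (p y) ;
  maxf_unit : p e <= 1 ;
  maxf_Nunit : p (- e) <= - 1
}.

Hypothesis e0 : 0 <=v e.

Lemma idealP x :
  I x <-> exists2 t : R, 0 < t & - (t *: e) <=v x /\ x <=v t *: e.
Proof.
split=> [[t xt1 xt2]|[t _ [? ?]]]; last by exists t.
have ts : t <= `|t| + 1 by rewrite (le_trans (ler_norm t))// lerDl.
exists (`|t| + 1); first by rewrite ltr_wpDl.
split; last by apply: vle_trans xt2 _; exact: vle_wZ.
by apply: vle_trans xt1; rewrite vleN2; exact: vle_wZ.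
Qed.

Lemma idealD x y : I x -> I y -> I (x + y).
Proof.
move=> [s xs1 xs2] [t yt1 yt2]; exists (s + t); rewrite scalerDl.
  by rewrite opprD vleD.
exact: vleD.
Qed.

Lemma idealN x : I x -> I (- x).
Proof.
by move=> [s xs1 xs2]; exists s; [rewrite vleN2|rewrite -vleN2 opprK].
Qed.

Lemma ideal_pscale c x : 0 <= c -> I x -> I (c *: x).
Proof.
move=> c0 [s xs1 xs2]; exists (c * s); rewrite -scalerA.
  by rewrite -scalerN vleZ.
exact: vleZ.
Qed.

Lemma idealZ c x : I x -> I (c *: x).
Proof.
move=> Ix; have [c0|c0] := leP 0 c; first exact: ideal_pscale.
by rewrite -[c]opprK scaleNr; apply/idealN/ideal_pscale; rewrite ?oppr_ge0 ?ltW.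
Qed.

Lemma ideal_unit : I e.
Proof.
exists 1; rewrite scale1r ?vle_refl//; apply: vle_trans e0.
by rewrite -vleN2 opprK oppr0.
Qed.

Lemma ideal0 : I 0.
Proof. by rewrite -(scale0r e); apply: idealZ ideal_unit. Qed.

Lemma ideal_squeeze x y z : I x -> I z -> x <=v y -> y <=v z -> I y.
Proof.
move=> /idealP[s s0 [xs _]] /idealP[t t0 [_ zt]] xy yz; exists (s + t).
  apply: vle_trans (vle_trans _ xs) xy.
  by rewrite vleN2 vle_wZ// lerDl ltW.
apply: vle_trans (vle_trans yz zt) _.
by rewrite vle_wZ// lerDr ltW.
Qed.

Lemma ideal_join x y : I x -> I y -> I (vjoin x y).
Proof.
move=> [s xs1 xs2] [t yt1 yt2]; exists (Num.max s t).
  apply: vle_trans (vle_trans _ xs1) (vle_joinl _ _).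
  by rewrite vleN2 vle_wZ// le_max lexx.
rewrite vjoin_le (vle_trans xs2) ?(vle_trans yt2)// vle_wZ// le_max lexx//.
by rewrite orbT.
Qed.

Lemma ideal_pos x : I x -> I (vpos x).
Proof. by move=> Ix; apply: ideal_join => //; exact: ideal0. Qed.

Lemma maxf_ge0 p : max_functional p -> 0 <= p 0.
Proof.
by move=> mp; have := maxf_add mp ideal0 ideal0; rewrite addr0 lerDl.
Qed.

Lemma maxf_lb x : I x ->
  exists b : R, forall p, max_functional p -> b <= p x.
Proof.
move=> Ix; have /idealP[t t0 [xt _]] := Ix; exists (- t) => p mp.
have It : I (t *: e) by exact/idealZ/ideal_unit.
have px : p (- x) <= t.
  apply: le_trans (maxf_mono mp _ It _) _ => //; first exact: idealN.
    by rewrite -vleN2 opprK.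
  apply: le_trans (maxf_scale mp t0 ideal_unit) _.
  by rewrite -[leRHS]mulr1 ler_wpM2l ?maxf_unit// ltW.
have := maxf_ge0 mp; rewrite -{1}(subrr x).
move=> /le_trans/(_ (maxf_add mp Ix (idealN Ix))).
by rewrite -lerBlDr sub0r => /(le_trans _); apply; rewrite lerN2.
Qed.

(** Downward directed families: the index k produced by each condition is
    what makes the infimum inherit the corresponding inequality. *)
Lemma inf_max_functional (T : Type) (q : T -> V -> R) (i0 : T) :
  (forall x, I x -> exists b, forall i, b <= q i x) ->
  (forall i j, exists k, forall x y, I x -> I y ->
    q k (x + y) <= q i x + q j y) ->
  (forall i c, 0 < c -> exists k, forall x, I x -> q k (c *: x) <= c * q i x) ->
  (forall i x y, I x -> I y -> x <=v y -> q i x <= q i y) ->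
  (forall i j, exists k, forall x, I x -> q k x <= q i x /\ q k x <= q j x) ->
  (forall i x y, I x -> I y -> q i (vjoin x y) <= Num.max (q i x) (q i y)) ->
  q i0 e <= 1 -> q i0 (- e) <= - 1 ->
  max_functional (fun x => inf (range (q^~ x))).
Proof.
move=> lb qD qZ qm qk qj qe qNe.
have near x d : I x -> 0 < d -> exists i, q i x < inf (range (q^~ x)) + d.
  by move=> Ix; apply: inf_range_near => //; exact: lb.
have le i x : I x -> inf (range (q^~ x)) <= q i x.
  by move=> Ix; apply: (inf_range_le (g := q^~ x)); exact: lb.
have d20 (d : R) : 0 < d -> 0 < d / 2 by move=> d0; rewrite divr_gt0.
split.
- move=> x y Ix Iy; apply/ler_addgt0Pr => d d0.
  have [[i qi] [j qj']] := (near x _ Ix (d20 _ d0), near y _ Iy (d20 _ d0)).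
  have [k qkD] := qD i j; apply: le_trans (le k _ (idealD Ix Iy)) _.
  apply: le_trans (qkD _ _ Ix Iy) _; rewrite [d]splitr addrACA.
  by rewrite lerD// ltW.
- move=> c x c0 Ix; rewrite -ler_pdivrMl//; apply/ler_addgt0Pr => d d0.
  have [i qi] := near x d Ix d0; have [k qkZ] := qZ i c c0.
  rewrite ler_pdivrMl//; apply: le_trans (le k _ (idealZ c Ix)) _.
  by apply: le_trans (qkZ _ Ix) _; rewrite ler_wpM2l// ltW.
- move=> x y Ix Iy xy; apply: le_inf_range => // i.
  exact: le_trans (le i x Ix) (qm _ _ _ Ix Iy xy).
- move=> x y Ix Iy; apply/ler_addgt0Pr => d d0.
  have [[i qi] [j qj']] := (near x _ Ix d0, near y _ Iy d0).
  have [k qkij] := qk i j; have [qkx _] := qkij x Ix; have [_ qky] := qkij y Iy.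
  apply: le_trans (le k _ (ideal_join Ix Iy)) _.
  apply: le_trans (qj k _ _ Ix Iy) _; rewrite addr_maxl ge_max !le_max.
  by rewrite (le_trans qkx (ltW qi)) (le_trans qky (ltW qj')) orbT.
- exact: le_trans (le i0 _ ideal_unit) qe.
- exact: le_trans (le i0 _ (idealN ideal_unit)) qNe.
Qed.

(** Passing from sup_K to the sup over the part of K where z is maximal. *)
Definition face_functional (p : V -> R) (z x : V) : R :=
  inf (range (fun t : {t : R | 0 <= t} => p (x + sval t *: z) - sval t * p z)).

Lemma maxf0 p : max_functional p -> p 0 = 0.
Proof.
move=> mp; have h : (0 : R) < 2^-1 by rewrite invr_gt0.
have := maxf_scale mp h ideal0; rewrite scaler0.
by have := maxf_ge0 mp; lra.
Qed.

Lemma maxf_pscale p t x : max_functional p -> 0 <= t -> I x ->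
  p (t *: x) = t * p x.
Proof.
move=> mp; rewrite le_eqVlt => /predU1P[<- _|t0 Ix].
  by rewrite scale0r mul0r maxf0.
apply/eqP; rewrite eq_le maxf_scale//= -ler_pdivlMl//.
have t'0 : 0 < t^-1 by rewrite invr_gt0.
have := maxf_scale mp t'0 (idealZ t Ix).
by rewrite scalerA mulVf ?gt_eqF// scale1r.
Qed.

Section face.
Context (p : V -> R) (z : V).
Hypotheses (mp : max_functional p) (Iz : I z).

Let q (t : {t : R | 0 <= t}) x := p (x + sval t *: z) - sval t * p z.

Let t0 : {t : R | 0 <= t} := exist _ 0 (lexx 0).

Let q_t0 x : q t0 x = p x.
Proof. by rewrite /q/= scale0r mul0r addr0 subr0. Qed.

Let Ixz x t : I x -> I (x + t *: z).
Proof. by move=> Ix; apply: idealD => //; exact: idealZ. Qed.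

Let q_lb x : I x -> exists b, forall i, b <= q i x.
Proof.
move=> Ix; exists (- p (- x)) => -[t t_ge0]; rewrite /q/=.
rewrite -(maxf_pscale mp t_ge0 Iz) -{2}(addKr x (t *: z)).
have := maxf_add mp (idealN Ix) (Ixz t Ix).
by set a := p (_ + _); set b := p (- x); set c := p (x + _); lra.
Qed.

Let q_near i j : exists k, forall x, I x -> q k x <= q i x /\ q k x <= q j x.
Proof.
move: i j => [s s0] [t t_ge0]; exists (exist _ (s + t) (addr_ge0 s0 t_ge0)).
move=> x Ix; rewrite /q/= scalerDl mulrDl; split.
  have := maxf_add mp (Ixz s Ix) (idealZ t Iz).
  by rewrite maxf_pscale// addrA; lra.
have := maxf_add mp (Ixz t Ix) (idealZ s Iz).
by rewrite maxf_pscale// [s *: z + _]addrC addrA; lra.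
Qed.

Lemma face_le x : I x -> face_functional p z x <= p x.
Proof.
by move=> Ix; rewrite -q_t0; apply: (inf_range_le (g := q^~ x)); exact: q_lb.
Qed.

Lemma face_opp : face_functional p z (- z) <= - p z.
Proof.
have := inf_range_le (q_lb (idealN Iz)) (exist _ 1 ler01).
by rewrite /q/= scale1r addNr (maxf0 mp) mul1r sub0r.
Qed.

Lemma face_max_functional : max_functional (face_functional p z).
Proof.
apply: (inf_max_functional (q := q) (i0 := t0)) => //; rewrite ?q_t0.
- move=> [s s0] [t t_ge0]; exists (exist _ (s + t) (addr_ge0 s0 t_ge0)).
  move=> x y Ix Iy; rewrite /q/= scalerDl mulrDl.
  have := maxf_add mp (Ixz s Ix) (Ixz t Iy).
  by rewrite addrACA; lra.
- move=> [t t_ge0] c c0; exists (exist _ (c * t) (mulr_ge0 (ltW c0) t_ge0)).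
  move=> x Ix; rewrite /q/= -scalerA -scalerDr mulrBr mulrA lerD2r.
  exact: maxf_scale (Ixz t Ix).
- move=> [t t_ge0] x y Ix Iy xy; rewrite /q/= lerD2r.
  by apply: (maxf_mono mp); rewrite ?vle_add2r//; exact: Ixz.
- move=> [t t_ge0] x y Ix Iy; rewrite /q/= vjoinDr -addr_maxl lerD2r.
  by apply: (maxf_join mp); exact: Ixz.
- exact: maxf_unit.
- exact: maxf_Nunit.
Qed.

End face.

(** A minimal functional equals its face at every z, hence is odd; a sublinear
    odd functional is linear. *)
Lemma minimal_state p : max_functional p ->
  (forall q, max_functional q -> (forall x, I x -> q x <= p x) ->
    forall x, I x -> p x <= q x) -> lattice_state p.
Proof.
move=> mp pmin.
have pN z : I z -> p (- z) = - p z.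
  move=> Iz; apply/eqP; rewrite eq_le; apply/andP; split.
    apply: le_trans (face_opp mp Iz); apply: pmin; last exact: idealN.
      exact: face_max_functional.
    exact: face_le.
  have := maxf_add mp Iz (idealN Iz).
  by rewrite subrr maxf0// addrC -lerBlDr sub0r.
have pD x y : I x -> I y -> p (x + y) = p x + p y.
  move=> Ix Iy; apply/eqP; rewrite eq_le maxf_add//=.
  have := maxf_add mp (idealD Ix Iy) (idealN Iy).
  by rewrite addrK pN// lerBrDr.
have pZ a x : I x -> p (a *: x) = a * p x.
  move=> Ix; have [a0|a0] := leP 0 a; first exact: maxf_pscale.
  rewrite -[a]opprK scaleNr pN; last exact: idealZ.
  by rewrite maxf_pscale ?mulNr// oppr_ge0 ltW.
split.
- by move=> a x y Ix Iy; rewrite pD ?pZ//; exact: idealZ.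
- move=> x y Ix Iy; apply/eqP; rewrite eq_le maxf_join//= ge_max.
  have Ixy := ideal_join Ix Iy.
  by rewrite !(maxf_mono mp) ?vle_joinl ?vle_joinr.
- apply/eqP; rewrite eq_le (maxf_unit mp)/= -lerN2 -pN ?(maxf_Nunit mp)//.
  exact: ideal_unit.
Qed.

(** Chains have their pointwise infimum as lower bound, so Zorn's lemma yields
    a minimal functional. *)
Lemma exists_state_below p0 : max_functional p0 ->
  exists2 p, lattice_state p & forall x, I x -> p x <= p0 x.
Proof.
move=> mp0.
pose T := {p | max_functional p /\ forall x, I x -> p x <= p0 x}.
pose below (p q : T) := `[< forall x, I x -> sval q x <= sval p x >].
have t0 : T by exists p0.
have [||A Atot|[p [mp pp0]] pmin] := @ZL_preorder T t0 below.
- by move=> p; apply/asboolP.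
- move=> p q r /asboolP pq /asboolP qr; apply/asboolP => x Ix.
  exact: le_trans (qr x Ix) (pq x Ix).
- have [[a0 Aa0]|/forallNP A0] := pselect (exists a, A a); last first.
    by exists t0 => a Aa; case: (A0 a).
  pose S := {a : T | A a}; pose q (s : S) : V -> R := sval (sval s).
  pose i0 : S := exist _ a0 Aa0.
  have mq (s : S) : max_functional (q s) by case: s => -[f []].
  have lbq x : I x -> exists b, forall s, b <= q s x.
    by move=> Ix; have [b bx] := maxf_lb Ix; exists b => s; exact: bx.
  have tot (i j : S) : exists k : S,
      forall x, I x -> q k x <= q i x /\ q k x <= q j x.
    have [/asboolP ij|/asboolP ji] := Atot _ _ (svalP i) (svalP j).
      by exists j => x Ix; split=> //; exact: ij.
    by exists i => x Ix; split=> //; exact: ji.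
  have mf : max_functional (fun x => inf (range (q^~ x))).
    apply: (inf_max_functional (i0 := i0)) => //.
    + move=> i j; have [k kij] := tot i j; exists k => x y Ix Iy.
      apply: le_trans (maxf_add (mq k) Ix Iy) _.
      by apply: lerD; [have [] := kij x Ix|have [] := kij y Iy].
    + by move=> i c c0; exists i => x Ix; exact: maxf_scale.
    + by move=> i; exact: maxf_mono.
    + by move=> i; exact: maxf_join.
    + exact: maxf_unit.
    + exact: maxf_Nunit.
  have le_q i x : I x -> inf (range (q^~ x)) <= q i x.
    by move=> Ix; apply: (inf_range_le (g := q^~ x)); exact: lbq.
  have mfp0 x : I x -> inf (range (q^~ x)) <= p0 x.
    by move=> Ix; apply: le_trans (le_q i0 x Ix) _; have [_] := svalP a0; exact.
  pose m : T := exist _ (fun x => inf (range (q^~ x))) (conj mf mfp0).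
  exists m => s As; apply/asboolP => x Ix /=.
  exact: (le_q (exist _ s As)).
exists p => //; apply: minimal_state => // q mq qp.
have qp0 x : I x -> q x <= p0 x.
  by move=> Ix; exact: le_trans (qp x Ix) (pp0 x Ix).
pose m : T := exist _ q (conj mq qp0).
have /asboolP pq : below m (exist _ p (conj mp pp0)).
  by apply: pmin; exact/asboolP.
exact: pq.
Qed.

Hypothesis archi : forall x, (forall t, 0 < t -> x <=v t *: e) -> x <=v 0.

(** The supremum over all points: the largest max functional. *)
Definition gauge (x : V) : R := inf [set t : R | x <=v t *: e].

Lemma gauge_max_functional : ~ e <=v 0 -> max_functional gauge.
Proof.
move=> ne0.
have lb x : I x -> exists b, forall t, x <=v t *: e -> b <= t.
  move=> [s xs _]; exists (- s) => t xt; rewrite leNgt; apply/negP => ts.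
  apply: ne0; rewrite -(@vle_pZ _ _ (- s - t)) ?subr_gt0// scaler0.
  rewrite scalerBl scaleNr -[0](subrr (t *: e)) vle_add2r.
  exact: vle_trans xs xt.
have gle x t : I x -> x <=v t *: e -> gauge x <= t.
  by move=> Ix xt; apply: ge_inf => //; have [b xb] := lb x Ix; exists b.
have gnear x d : I x -> 0 < d ->
    exists2 t, x <=v t *: e & t < gauge x + d.
  move=> Ix /inf_adherent; apply; split; first by case: Ix => t _ xt; exists t.
  by have [b xb] := lb x Ix; exists b.
split.
- move=> x y Ix Iy; apply/ler_addgt0Pr => d d0.
  have d20 : 0 < d / 2 by rewrite divr_gt0.
  have [[s xs sx] [t yt ty]] := (gnear x _ Ix d20, gnear y _ Iy d20).
  apply: (@le_trans _ _ (s + t)); last first.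
    by rewrite [d]splitr addrACA lerD// ltW.
  by apply: gle; rewrite ?scalerDl; [exact: idealD|exact: vleD].
- move=> c x c0 Ix; rewrite -ler_pdivrMl//; apply/ler_addgt0Pr => d d0.
  have [t xt tx] := gnear x _ Ix d0; rewrite ler_pdivrMl//.
  apply: (@le_trans _ _ (c * t)); last by rewrite ler_wpM2l// ltW.
  by apply: gle; [exact: idealZ|rewrite -scalerA vleZ// ltW].
- move=> x y Ix Iy xy; apply/ler_addgt0Pr => d d0.
  have [t yt ty] := gnear y _ Iy d0; apply: le_trans (ltW ty).
  exact: gle (vle_trans xy yt).
- move=> x y Ix Iy; apply/ler_addgt0Pr => d d0.
  have [[s xs sx] [t yt ty]] := (gnear x _ Ix d0, gnear y _ Iy d0).
  apply: (@le_trans _ _ (Num.max s t)); last first.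
    by rewrite addr_maxl ge_max !le_max (ltW sx) (ltW ty) orbT.
  apply: gle; first exact: ideal_join.
  by rewrite vjoin_le (vle_trans xs) ?(vle_trans yt)// vle_wZ// le_max lexx
    ?orbT.
- by apply: gle; [exact: ideal_unit|rewrite scale1r vle_refl].
- by apply: gle; [exact/idealN/ideal_unit|rewrite scaleN1r vle_refl].
Qed.

(** Start the descent at the face of the gauge on which a is maximal, so that
    the state obtained takes at a at least the value of the gauge. *)
Lemma exists_state_gt0 a : I a -> ~ a <=v 0 ->
  exists2 f, lattice_state f & 0 < f a.
Proof.
move=> Ia na0.
have ne0 : ~ e <=v 0.
  move=> en0; apply: na0; case: Ia => t _ at_.
  by apply: vle_trans at_ _; rewrite (vle_eq en0 e0) scaler0 vle_refl.
have mg := gauge_max_functional ne0.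
have ga : 0 < gauge a.
  rewrite ltNge; apply/negP => ga0; apply: na0; apply: archi => t t0.
  have : has_inf [set t : R | a <=v t *: e].
    split; first by case: Ia => s _ as_; exists s.
    case: Ia => s as_ _; exists (- s) => u au; rewrite leNgt; apply/negP => us.
    apply: ne0; rewrite -(@vle_pZ _ _ (- s - u)) ?subr_gt0// scaler0.
    rewrite scalerBl scaleNr -[0](subrr (u *: e)) vle_add2r.
    exact: vle_trans as_ au.
  move=> /(inf_adherent t0)[u au ut]; apply: vle_trans au _.
  by rewrite vle_wZ// ltW// (lt_le_trans ut)// -/(gauge a) gerDr.
have [f sf fle] := exists_state_below (face_max_functional mg Ia).
exists f => //; have INa := idealN Ia.
have := le_trans (fle _ INa) (face_opp mg Ia).
have := state_linear sf (-1) Ia ideal0; rewrite addr0 scaleN1r => ->.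
have := state_linear sf 1 ideal0 ideal0; rewrite scale1r addr0.
by lra.
Qed.

End principal_ideal.

(** * Compactness and the lattice form of the Stone-Weierstrass theorem *)

(** Otherwise the complements of the sets with the property P would form a
    proper filter without cluster point. *)
Lemma compact_induction (X : topologicalType) (P : set X -> Prop) :
  compact [set: X] -> P set0 ->
  (forall A B, P A -> P B -> P (A `|` B)) ->
  (forall A B, A `<=` B -> P B -> P A) ->
  (forall x : X, exists2 A, nbhs x A & P A) -> P setT.
Proof.
move=> cX P0 PU Psub Pnear; apply: contrapT => nPT.
pose F := [set A : set X | P (~` A)].
have FF : ProperFilter F.
  split; first by rewrite /F/= setC0.
  split; first by rewrite /F/= setCT.
  - by move=> A B; rewrite /F/= setCI; exact: PU.
  - by move=> A B AB; rewrite /F/=; apply: Psub; exact: subsetC.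
have [|x [_ Fx]] := cX F FF; first by rewrite /F/= setCT.
have [A xA PA] := Pnear x.
have [|y []] := Fx (~` A) A _ xA; first by rewrite /F/= setCK.
by [].
Qed.

Section lattice_stone_weierstrass.
Context {R : realType} {X : topologicalType}.
Context (L : set (X -> R)).
Hypothesis cX : compact [set: X].
Hypothesis L_cts : forall g, L g -> continuous g.
Hypothesis L_ex : exists g, L g.
Hypothesis L_min : forall g h, L g -> L h -> L (fun x => Num.min (g x) (h x)).
Hypothesis L_max : forall g h, L g -> L h -> L (fun x => Num.max (g x) (h x)).

Let nbhs_lt (g h : X -> R) x : continuous g -> continuous h ->
  g x < h x -> nbhs x [set y | g y < h y].
Proof.
move=> gc hc gh.
have : continuous (fun y => h y - g y).
  by move=> y; apply: cvgB; [exact: hc|exact: gc].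
move=> /(_ x) /(@cvgr_gt R _ _ _ _)/(_ 0).
rewrite subr_gt0 => /(_ gh); apply: filterS => y /=.
by rewrite subr_gt0.
Qed.

(** Interpolating f at the pairs (x, y) first yields, by compactness in y,
    functions equal to f at x and nowhere much above f, then, by compactness
    in x, one that is also nowhere much below f. *)
Lemma lattice_dense (f : X -> R) d : continuous f -> 0 < d ->
  (forall x y, exists2 g, L g & g x = f x /\ g y = f y) ->
  exists2 g, L g & forall x, f x - d < g x < f x + d.
Proof.
move=> fc d0 fL; have [g0 Lg0] := L_ex.
have cst_c (c : R) : continuous (fun x => f x + c).
  by move=> x; apply: cvgD; [exact: fc|exact: cvg_cst].
have up x : exists2 g, L g & g x = f x /\ forall y, g y < f y + d.
  suff [g Lg [gx gy]] : exists2 g, L g &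
      g x = f x /\ forall y, setT y -> g y < f y + d.
    by exists g => //; split=> // y; exact: gy.
  apply: (compact_induction (P := fun A => exists2 g, L g &
    g x = f x /\ forall y, A y -> g y < f y + d) cX).
  - by have [g Lg [gx _]] := fL x x; exists g.
  - move=> A B [g Lg [gx gA]] [h Lh [hx hB]].
    exists (fun y => Num.min (g y) (h y)); first exact: L_min.
    split=> [|y [/gA|/hB] yd]; first by rewrite gx hx minxx.
      by rewrite gt_min yd.
    by rewrite gt_min yd orbT.
  - by move=> A B AB [g Lg [gx gB]]; exists g => //; split=> // y /AB/gB.
  - move=> y; have [g Lg [gx gy]] := fL x y.
    exists [set y | g y < f y + d]; last by exists g.
    by apply: nbhs_lt; [exact: L_cts|exact: cst_c|rewrite gy ltrDl].
suff [g Lg gfd] : exists2 g, L g &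
    (forall x, setT x -> f x - d < g x) /\ forall x, g x < f x + d.
  by exists g => // x; apply/andP; split; apply gfd.
apply: (compact_induction (P := fun A => exists2 g, L g &
  (forall x, A x -> f x - d < g x) /\ forall x, g x < f x + d) cX).
- have [[x]|/forallNP X0] := pselect (exists x : X, True); last first.
    by exists g0 => //; split=> // x; case: (X0 x).
  by have [g Lg [_ gd]] := up x; exists g.
- move=> A B [g Lg [gA gd]] [h Lh [hB hd]].
  exists (fun y => Num.max (g y) (h y)); first exact: L_max.
  split=> [x [/gA|/hB] xd|x]; rewrite ?lt_max ?xd ?orbT//.
  by rewrite gt_max gd hd.
- by move=> A B AB [g Lg [gB gd]]; exists g => //; split=> // x /AB/gB.
- move=> x; have [g Lg [gx gd]] := up x.
  exists [set y | f y - d < g y]; last by exists g.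
  apply: nbhs_lt; [exact: (cst_c (- d))|exact: L_cts|].
  by rewrite gx gtrDl oppr_lt0.
Qed.

End lattice_stone_weierstrass.

Lemma compact_set_type (X : topologicalType) (A : set X) :
  compact A -> compact [set: set_type A].
Proof.
move=> cA F FF _.
have [|x [Ax xF]] := cA (set_val @ F) (fmap_proper_filter _ FF).
  by apply: (@filterE _ F) => x; exact: set_valP.
pose y : set_type A := exist _ x (mem_set Ax).
exists y; split => // B C FB.
rewrite nbhsE => -[_ [[D oD <-] Dy] DC].
have FB' : F (set_val @^-1` (set_val @` B)).
  by apply: filterS FB => z Bz; exists z.
have [|_ [[z Bz <-] Dz]] := xF (set_val @` B) D FB'.
  exact: open_nbhs_nbhs.
by exists z; split=> //; exact: DC.
Qed.

(** * The weighted algebra of continuous functions as a Banach f-algebra *)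

(** The norm below is finite only because the cylinder is compact; carrying
    the proof of compactness in the type lets the instances depend on it. *)
Definition supC (R : realType) (E : normedModType R)
  (cX : compact [set: dual_cylinder E]) : Type := weightedC E.

Section weighted_banach.
Context {R : realType} {E : normedModType R}.
Context {cX : compact [set: dual_cylinder E]}.
Local Notation X := (dual_cylinder E).
Local Notation W := (supC cX).

HB.instance Definition _ := VectorLatticeAlgebra.on W.

Implicit Types f g h : W.

Let ev f (k : X) : R := (f : weightedC E) k.

Lemma supC_ext f g : (forall k, ev f k = ev g k) -> f = g.
Proof. by move=> fg; apply: weightedC_ext. Qed.

Fact weight_itv (k : X) : 0 <= \val k.1 <= 1.
Proof. by have /set_mem := valP k.1; rewrite /= in_itv. Qed.

Let vmeetE f g k : ev (vmeet f g) k = Num.min (ev f k) (ev g k).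
Proof. by []. Qed.

Let zeroE k : ev 0 k = 0. Proof. by []. Qed.

Let vmulE f g k : ev (vmul f g) k = \val k.1 * ev f k * ev g k.
Proof. by []. Qed.

Let vleP f g : reflect (forall k, ev f k <= ev g k) (f <=v g).
Proof. exact: asboolP. Qed.

Fact supC_mull f g h : vmeet f g = 0 -> 0 <=v h -> vmeet (vmul f h) g = 0.
Proof.
move=> fg0 /vleP h0; apply: supC_ext => k; rewrite vmeetE vmulE zeroE.
have := congr1 (ev^~ k) fg0; rewrite vmeetE zeroE.
have := h0 k; rewrite zeroE; have /andP[r0 _] := weight_itv k.
move: (ev f k) (ev g k) (ev h k) => a b c c0.
have [ab a0|ba b0] := leP a b; first by rewrite a0 mulr0 mul0r min_l// -a0.
by rewrite b0 in ba *; rewrite min_r// !mulr_ge0// ltW.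
Qed.

Fact supC_mulr f g h : vmeet f g = 0 -> 0 <=v h -> vmeet (vmul h f) g = 0.
Proof.
rewrite (_ : vmul h f = vmul f h); first exact: supC_mull.
by apply: supC_ext => k; rewrite !vmulE mulrAC.
Qed.

HB.instance Definition _ :=
  VectorLatticeAlgebra_isFAlgebra.Build R W supC_mull supC_mulr.

Definition sup_norm f : R := sup (range (fun k => `|ev f k|)).

Lemma supC_bounded f : exists M, forall k, `|ev f k| <= M.
Proof.
suff [M fM] : exists M, forall k, [set: X] k -> `|ev f k| <= M.
  by exists M => k; exact: fM.
apply: (compact_induction (P := fun A => exists M : R,
  forall k, A k -> `|ev f k| <= M) cX).
- by exists 0.
- move=> A B [M fM] [N fN]; exists (Num.max M N) => k [/fM|/fN] h.
    by rewrite le_max h.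
  by rewrite le_max h orbT.
- by move=> A B AB [M fM]; exists M => k /AB/fM.
- move=> k; exists [set l | `|ev f k - ev f l| < 1].
    have := @cts_fun _ _ (f : continuousType _ _) k.
    by move/cvgrPdist_lt => /(_ _ ltr01).
  exists (`|ev f k| + 1) => l /= kl; rewrite -lerBlDl.
  by apply: le_trans (ltW kl); rewrite distrC lerB_dist.
Qed.

Lemma sup_norm_ub f k : `|ev f k| <= sup_norm f.
Proof.
apply: ub_le_sup; last by exists k.
by have [M fM] := supC_bounded f; exists M => _ [l _ <-].
Qed.

Lemma sup_norm_le f M : 0 <= M -> (forall k, `|ev f k| <= M) -> sup_norm f <= M.
Proof.
move=> M0 fM; rewrite /sup_norm; have [->|/set0P S0] :=
  eqVneq (range (fun k => `|ev f k|)) set0; first by rewrite sup0.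
by apply: ge_sup => // _ [k _ <-].
Qed.

Lemma sup_norm_ge0 f : 0 <= sup_norm f.
Proof.
rewrite /sup_norm; have [->|/set0P[_ [k _ _]]] :=
  eqVneq (range (fun k => `|ev f k|)) set0; first by rewrite sup0.
exact: le_trans (sup_norm_ub f k).
Qed.

Fact sup_normD f g : sup_norm (f + g) <= sup_norm f + sup_norm g.
Proof.
apply: sup_norm_le => [|k]; first by rewrite addr_ge0 ?sup_norm_ge0.
by apply: le_trans (ler_normD _ _) _; rewrite lerD ?sup_norm_ub.
Qed.

Fact sup_normZ a f : sup_norm (a *: f) = `|a| * sup_norm f.
Proof.
have le b g : sup_norm (b *: g) <= `|b| * sup_norm g.
  apply: sup_norm_le => [|k]; first by rewrite mulr_ge0 ?sup_norm_ge0.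
  by rewrite [ev _ _]/(b * ev g k) normrM ler_wpM2l ?sup_norm_ub.
apply/eqP; rewrite eq_le le /=; have [->|a0] := eqVneq a 0.
  by rewrite normr0 mul0r sup_norm_ge0.
rewrite -ler_pdivlMl ?normr_gt0// -normfV.
by apply: le_trans (le _ _); rewrite scalerA mulVf// scale1r.
Qed.

Fact sup_norm_eq0 f : sup_norm f = 0 -> f = 0.
Proof.
move=> f0; apply: supC_ext => k; apply/eqP.
by rewrite -normr_le0 -f0 sup_norm_ub.
Qed.

HB.instance Definition _ := Lmodule_isNormed.Build R W
  sup_normD sup_normZ sup_norm_eq0.

Lemma supC_norm_ub f k : `|ev f k| <= `|f|.
Proof. exact: sup_norm_ub. Qed.

Lemma supC_norm_le f M : 0 <= M -> (forall k, `|ev f k| <= M) -> `|f| <= M.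
Proof. exact: sup_norm_le. Qed.

Fact supC_complete (F : set_system W) : ProperFilter F -> cauchy F -> cvg F.
Proof.
move=> FF /cauchyP Fc.
have evB g h k : ev (g - h) k = ev g k - ev h k by [].
have ball_ev g h d k : ball g d h -> `|ev g k - ev h k| < d.
  by rewrite -ball_normE /= -evB; apply: le_lt_trans; exact: supC_norm_ub.
have ev_cvg k : cvg (ev^~ k @ F).
  apply: cauchy_cvg; apply: cauchy_exP => d d0; have [g Fg] := Fc d d0.
  exists (ev g k); suff : F (ev^~ k @^-1` ball (ev g k) d) by [].
  apply: filterS Fg => h /(ball_ev _ _ _ k).
  by rewrite /= -ball_normE.
pose l k : R := lim (ev^~ k @ F).
have le_l g d k : F (ball g d) -> `|ev g k - l k| <= d.
  move=> Fg; have : (fun h => `|ev g k - ev h k|) @ F --> `|ev g k - l k|.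
    by apply: cvg_norm; apply: cvgB; [exact: cvg_cst|exact: ev_cvg].
  move=> /cvgr_to_le; apply.
  by apply: filterS Fg => h /(ball_ev _ _ _ k)/ltW.
have lc : continuous l.
  move=> k; apply/cvgrPdist_lt => d d0; have d3 : 0 < d / 3 by rewrite divr_gt0.
  have [g Fg] := Fc _ d3.
  have := @cts_fun _ _ (g : continuousType _ _) k.
  move/cvgrPdist_lt => /(_ _ d3); apply: filterS => m gm.
  rewrite (_ : l k - l m = (ev g k - ev g m) - (ev g k - l k) +
    (ev g m - l m)); last by ring.
  apply: le_lt_trans (ler_normD _ _) _.
  apply: (@lt_le_trans _ _ (d / 3 + d / 3 + d / 3)); last by lra.
  rewrite ltr_leD ?le_l//; apply: le_lt_trans (ler_normB _ _) _.
  by rewrite ltr_leD ?le_l.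
pose f : W := (mkcts lc : continuousType _ _).
apply/cvg_ex; exists f; apply/cvg_ballP => d d0.
have d3 : 0 < d / 3 by rewrite divr_gt0.
have [g Fg] := Fc _ d3; apply: filterS (Fg) => h gh.
rewrite -ball_normE /=; apply: (@le_lt_trans _ _ (d / 3 + d / 3)); last by lra.
apply: supC_norm_le => [|k]; first by lra.
rewrite (_ : ev (f - h) k = (ev g k - ev h k) - (ev g k - l k)); last first.
  by rewrite evB -[ev f k]/(l k); ring.
apply: le_trans (ler_normB _ _) _.
by rewrite lerD ?le_l// ltW// ball_ev.
Qed.

HB.instance Definition _ := Uniform_isComplete.Build W supC_complete.

Let vabsE f k : ev (vabs f) k = `|ev f k|.
Proof. exact: maxrN. Qed.

Fact supC_lattice_norm f g : vabs f <=v vabs g -> `|f| <= `|g|.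
Proof.
move=> /vleP fg; apply: supC_norm_le => // k.
by rewrite (le_trans _ (supC_norm_ub g k))// -!vabsE.
Qed.

Fact supC_normM f g : `|vmul f g| <= `|f| * `|g|.
Proof.
apply: supC_norm_le => [|k]; first exact: mulr_ge0.
rewrite vmulE !normrM; have /andP[r0 r1] := weight_itv k.
rewrite ler_pM ?supC_norm_ub ?mulr_ge0// (le_trans _ (supC_norm_ub f k))//.
by rewrite ger0_norm// ler_piMl.
Qed.

HB.instance Definition _ :=
  isSubmultiplicativeLatticeNormed.Build R W supC_lattice_norm supC_normM.

End weighted_banach.

(** * Finite-dimensional spaces and their dual spheres *)

Section finite_dimension.
Context {R : realType}.

Lemma lipschitz_linear_continuous (E F : normedModType R) (f : E -> F) (C : R) :
  linear f -> (forall x, `|f x| <= C * `|x|) -> continuous f.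
Proof.
move=> fl fC x; apply/cvgrPdist_lt => d d0.
have C0 : 0 < `|C| + 1 by rewrite ltr_wpDl.
have : nbhs x [set y | `|x - y| < d / (`|C| + 1)].
  by apply/nbhs_normP; exists (d / (`|C| + 1)) => //=; rewrite divr_gt0.
apply: filterS => y /=; rewrite ltr_pdivlMr// => xy.
rewrite -(linear_funB fl); apply: le_lt_trans (fC _) _.
apply: le_lt_trans xy; rewrite mulrC ler_wpM2l//.
by rewrite (le_trans (ler_norm C))// lerDl.
Qed.

Lemma rV_norm_entry n (v : 'rV[R]_n) i : `|v ord0 i| <= `|v|.
Proof.
rewrite [leRHS]/Num.norm /= mx_normrE.
by apply/bigmax_geP; right => /=; exists (ord0, i).
Qed.

(** The coordinate functionals are bounded because the norm of E attains a
    positive minimum on the compact unit sphere of R^n. *)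
Lemma finite_dimensional_basis (E : normedModType R) : finite_dimensional E ->
  exists n (b : 'I_n -> E) (xi : 'I_n -> E -> R) (C : R),
    [/\ 0 < C, forall i, linear (xi i),
        forall x, x = \sum_i xi i x *: b i &
        forall i x, `|xi i x| <= C * `|x|].
Proof.
move=> [n [f fl [g fK gK]]].
have gl : linear g.
  by move=> a u v; apply: (can_inj fK); rewrite fl !gK.
pose b i := g (delta_mx ord0 i).
have gE v : g v = \sum_i v ord0 i *: b i.
  rewrite {1}(row_sum_delta v) (linear_fun_sum gl).
  by apply: eq_bigr => i _; rewrite (linear_funZ gl).
have gc : continuous g.
  apply: (@lipschitz_linear_continuous _ _ _ (\sum_i `|b i|)) => // v.
  rewrite gE (le_trans (ler_norm_sum _ _ _))// mulr_suml ler_sum// => i _.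
  by rewrite normrZ mulrC ler_wpM2l// rV_norm_entry.
have [C C0 fC] : exists2 C, 0 < C & forall x, `|f x| <= C * `|x|.
  pose S := [set v : 'rV[R]_n | `|v| = 1].
  have unit_S v : v != 0 -> S (`|v|^-1 *: v).
    by move=> v0; rewrite /S/= normrZ normfV normr_id mulVf// normr_eq0.
  have [S0|/set0P S0] := eqVneq S set0.
    exists 1 => // x; rewrite mul1r; have [->|fx0] := eqVneq (f x) 0.
      by rewrite normr0.
    by have := unit_S _ fx0; rewrite S0.
  have cS : compact S.
    apply: bounded_closed_compact.
      by exists 1; split=> // M M1 v /= ->; exact: ltW.
    apply: (@preimage_closed _ _ (fun v : 'rV[R]_n => `|v|) [set 1]) => [v _|].
      exact: norm_continuous.
    exact: closed_eq.
  have gnc : {within S, continuous (fun v => `|g v|)}.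
    apply: continuous_subspaceT => v.
    by apply: (@continuous_comp _ _ _ g); [exact: gc|exact: norm_continuous].
  have [v vS vmin] := compact_EVT_min S0 cS gnc.
  have gv0 : 0 < `|g v|.
    rewrite normr_gt0; apply/eqP => gv0; move: vS; rewrite inE /S/=.
    rewrite -[v]gK gv0 (linear_fun0 fl) normr0 => /eqP.
    by rewrite eq_sym oner_eq0.
  exists (`|g v|^-1); first by rewrite invr_gt0.
  move=> x; rewrite ler_pdivlMl//.
  have [->|fx0] := eqVneq (f x) 0; first by rewrite normr0 mulr0.
  have := vmin _ (mem_set (unit_S _ fx0)).
  rewrite (linear_funZ gl) fK normrZ normfV normr_id.
  by rewrite ler_pdivlMl ?normr_gt0// mulrC.
exists n, b, (fun i x => f x ord0 i), C; split=> //.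
- by move=> i a x y; rewrite fl !mxE.
- by move=> x; rewrite -gE fK.
- by move=> i x; apply: le_trans (fC x); exact: rV_norm_entry.
Qed.

Lemma dual_le (E : normedModType R) (u : dual E) x : `|u x| <= `|u| * `|x|.
Proof.
have [->|x0] := eqVneq x 0; first by rewrite linear0 !normr0 mulr0.
have nx0 : 0 < `|x| by rewrite normr_gt0.
have : `|u (`|x|^-1 *: x)| <= `|u|.
  by apply: dual_norm_ub; rewrite normrZ normfV normr_id mulVf ?gt_eqF.
by rewrite linearZ/= normrM normfV normr_id ler_pdivrMl// mulrC.
Qed.

(** The coordinates in the dual basis identify the sphere with a closed and
    bounded subset of R^n. *)
Lemma dual_sphere_compact (E : normedModType R) :
  finite_dimensional E -> compact [set u : dual E | `|u| = 1].
Proof.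
move=> /finite_dimensional_basis[n [b [xi [C [C0 xil xE xiC]]]]].
pose xid i := Dual (xil i) (lipschitz_linear_continuous (xil i) (xiC i)).
pose D (v : 'rV[R]_n) : dual E := \sum_i v ord0 i *: xid i.
have Dl : linear D.
  move=> a v w; rewrite /D scaler_sumr -big_split/=; apply: eq_bigr => i _.
  by rewrite !mxE scalerDl scalerA.
have Dc : continuous D.
  apply: (@lipschitz_linear_continuous _ _ _ (\sum_i `|xid i|)) => // v.
  rewrite (le_trans (ler_norm_sum _ _ _))// mulr_suml ler_sum// => i _.
  by rewrite normrZ mulrC ler_wpM2l// rV_norm_entry.
have dual_sumE (v : 'rV[R]_n) x : D v x = \sum_i v ord0 i * xi i x.
  rewrite /D; elim/big_rec2: _ => // i y u _ <-.
  by [].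
have DK (u : dual E) : D (\row_i u (b i)) = u.
  apply: dual_ext => x; rewrite dual_sumE {2}(xE x) linear_sum/=.
  by apply: eq_bigr => i _; rewrite mxE linearZ/= mulrC.
pose K := [set v : 'rV[R]_n | `|D v| = 1] `&` [set v | `|v| <= \sum_i `|b i|].
rewrite (_ : [set u : dual E | `|u| = 1] = D @` K).
  apply: continuous_compact; first exact: continuous_subspaceT.
  apply: bounded_closed_compact.
    exists (\sum_i `|b i|); split; first by rewrite num_real.
    by move=> M M1 v [_ /= vb]; exact: le_trans vb (ltW M1).
  apply: closedI.
    apply: (@preimage_closed _ _ (fun v => `|D v|) [set 1]) => [v _|].
      by apply: (@continuous_comp _ _ _ D); [exact: Dc|exact: norm_continuous].
    exact: closed_eq.
  apply: (@preimage_closed _ _ (fun v : 'rV[R]_n => `|v|)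
    [set t | t <= \sum_i `|b i|]) => [v _|]; first exact: norm_continuous.
  exact: closed_le.
apply/seteqP; split=> [u /= u1|_ [v [v1 _] <-] //].
exists (\row_i u (b i)); last exact: DK.
split; rewrite /= ?DK//.
rewrite [leLHS]/Num.norm /= mx_normrE; apply: bigmax_le => [|[j i] _ /=].
  exact: sumr_ge0.
rewrite mxE (bigD1 i)//= (le_trans (dual_le u _))// u1 mul1r lerDl.
exact: sumr_ge0.
Qed.

Lemma dual_cylinder_compact (E : normedModType R) :
  finite_dimensional E -> compact [set: dual_cylinder E].
Proof.
move=> fd; rewrite -setXTT; apply: compact_setX; apply: compact_set_type.
  exact: segment_compact.
exact: dual_sphere_compact.
Qed.

End finite_dimension.

(** * Lattice states are multiplicative up to a weight *)

Section state_theory.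
Context {R : realType} {V : vectorLatticeType R} (e : V) (f : V -> R).
Hypotheses (e0 : 0 <=v e) (sf : lattice_state e f).
Local Notation I := (principal_ideal e).

Lemma stateD x y : I x -> I y -> f (x + y) = f x + f y.
Proof.
by move=> Ix Iy; have := state_linear sf 1 Ix Iy; rewrite scale1r mul1r.
Qed.

Lemma state0 : f 0 = 0.
Proof.
have I0 := ideal0 e0; have := stateD I0 I0; rewrite addr0; lra.
Qed.

Lemma stateZ a x : I x -> f (a *: x) = a * f x.
Proof.
move=> Ix; have := state_linear sf a Ix (ideal0 e0).
by rewrite state0 !addr0.
Qed.

Lemma stateN x : I x -> f (- x) = - f x.
Proof. by move=> Ix; rewrite -scaleN1r stateZ// mulN1r. Qed.

Lemma stateB x y : I x -> I y -> f (x - y) = f x - f y.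
Proof. by move=> Ix Iy; rewrite stateD ?stateN//; exact: idealN. Qed.

Lemma state_le x y : I x -> I y -> x <=v y -> f x <= f y.
Proof.
move=> Ix Iy xy; have := state_join sf Iy Ix.
by rewrite vjoin_idPl// => ->; rewrite le_max lexx orbT.
Qed.

Lemma state_ge0 x : I x -> 0 <=v x -> 0 <= f x.
Proof. by move=> Ix x0; rewrite -state0 state_le//; exact: ideal0. Qed.

Lemma state_meet x y : I x -> I y -> f (vmeet x y) = Num.min (f x) (f y).
Proof.
move=> Ix Iy; have [INx INy] := (idealN Ix, idealN Iy).
rewrite -[vmeet _ _]opprK oppr_vmeet stateN; last exact: ideal_join.
by rewrite (state_join sf)// !stateN// oppr_max !opprK.
Qed.

Lemma state_abs x : I x -> f (vabs x) = `|f x|.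
Proof.
by move=> Ix; rewrite (state_join sf) ?stateN ?maxrN//; exact: idealN.
Qed.

Lemma ideal_sum n (F : 'I_n -> V) :
  (forall i, I (F i)) -> I (\sum_i F i) /\ f (\sum_i F i) = \sum_i f (F i).
Proof.
move=> IF; elim/big_rec2: _ => [|i y x _ [Ix <-]].
  by split; [exact: ideal0|exact: state0].
by split; [exact: idealD|exact: stateD].
Qed.

(** If f x = 0 the part of x above s e is disjoint from an element not
    killed by f; its image under p is so as well, hence killed by f. *)
Lemma state_ortho_ker (p : V -> V) x : orthomorphism p ->
  (forall y, I y -> I (p y)) -> I x -> 0 <=v x -> f x = 0 -> f (p x) = 0.
Proof.
move=> po pI Ix x0 fx0; have Ie := ideal_unit e0.
have pl := ortho_linear po.
apply/eqP; rewrite eq_le state_ge0 ?(ortho_ge0 po)// ?andbT; last exact: pI.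
have fpe0 : 0 <= f (p e) by rewrite state_ge0 ?(ortho_ge0 po)//; exact: pI.
apply/ler_addgt0Pr => d d0; rewrite add0r.
pose s := d / (f (p e) + 1).
have q0 : 0 < f (p e) + 1 by rewrite ltr_wpDl.
have s0 : 0 < s by rewrite divr_gt0.
have Ise : I (s *: e) by exact: idealZ.
have Ixs : I (x - s *: e) by apply: idealD => //; exact: idealN.
have Ip := ideal_pos e0 Ixs; have IpN := ideal_pos e0 (idealN Ixs).
have f_high : f (p (vpos (x - s *: e))) = 0.
  have := state_meet (pI _ Ip) IpN.
  rewrite (ortho_disj po (vpos_disj _)) state0 /vpos.
  rewrite [f (vjoin (- _) _)](state_join sf) ?opprB; last exact: ideal0.
    rewrite state0 stateB// stateZ// (state_unit sf) fx0 subr0 mulr1.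
    rewrite (max_l (ltW s0)); set a := f _.
    move=> /esym; case: (leP a s) => // _ sE.
    by move: s0; rewrite sE ltxx.
  by rewrite -opprB; exact: idealN.
have : x <=v vpos (x - s *: e) + s *: e.
  by rewrite -(vle_add2r (- (s *: e))) addrK vle_vpos.
move=> /(ortho_mono po); rewrite (linear_funD pl) (linear_funZ pl).
have [Ipp Ipe] := (pI _ Ip, pI _ Ie); have Ispe := idealZ s Ipe.
move=> /(state_le (pI _ Ix) (idealD Ipp Ispe)).
rewrite stateD// f_high add0r stateZ// => /le_trans; apply.
by rewrite /s mulrAC ler_pdivrMr// ler_wpM2l ?(ltW d0)// lerDl.
Qed.

(** The element x - f x *: e is killed by f, hence so is its image under p. *)
Lemma state_ortho (p : V -> V) x : orthomorphism p ->
  (forall y, I y -> I (p y)) -> I x -> f (p x) = f x * f (p e).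
Proof.
move=> po pI Ix; have Ie := ideal_unit e0; have pl := ortho_linear po.
pose z := x - f x *: e.
have Iz : I z by apply: idealD => //; exact/idealN/idealZ.
have fz : f z = 0.
  by rewrite stateB ?stateZ ?(state_unit sf) ?mulr1 ?subrr//; exact: idealZ.
have fz_pos y : I y -> f y = 0 -> f (p (vpos y)) = 0.
  move=> Iy fy.
  apply: state_ortho_ker => //; [exact: ideal_pos|exact: vpos_ge0|].
  by rewrite (state_join sf) ?fy ?state0 ?maxxx//; exact: ideal0.
have fpz : f (p z) = 0.
  have INz := idealN Iz.
  rewrite -(vpos_sub z) (linear_funB pl) stateB; first last.
  - exact/pI/ideal_pos.
  - exact/pI/ideal_pos.
  - by rewrite !fz_pos ?subr0// stateN// fz oppr0.
rewrite -[x in LHS](subrK (f x *: e)) -/z (linear_funD pl) (linear_funZ pl).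
rewrite stateD ?fpz ?add0r ?stateZ//; [exact: pI|exact: pI|exact/idealZ/pI].
Qed.

End state_theory.

Section state_product.
Context {R : realType} {A : banachFAlgType R} (e : A).
Hypothesis e0 : 0 <=v e.
Local Notation I := (principal_ideal e).

Lemma ideal_mul x y : I x -> I y -> I (vmul x y).
Proof.
have pos a b : 0 <=v a -> 0 <=v b -> I b -> I (vmul a b).
  move=> a0 b0 Ib; apply: (ideal_squeeze e0 (ideal0 e0) (idealZ `|a| Ib)).
    exact: vmul_ge0.
  exact: vmul_le.
have posl a b : 0 <=v a -> I b -> I (vmul a b).
  move=> a0 Ib; rewrite -(vpos_sub b) (linear_funB (vmull_linear a)).
  apply: idealD; last apply: idealN; apply: pos; rewrite ?vpos_ge0//.
    exact: ideal_pos.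
  exact/ideal_pos/idealN.
move=> _ Iy; rewrite -(vpos_sub x) (linear_funB (vmulr_linear y)).
by apply: idealD; last apply: idealN; apply: posl; rewrite ?vpos_ge0.
Qed.

(** Apply the previous description of f on images of orthomorphisms first to
    the right multiplication by e, then to the left multiplications by the
    positive and negative parts of x. *)
Lemma state_mul f x y : lattice_state e f -> I x -> I y ->
  f (vmul x y) = f x * f y * f (vmul e e).
Proof.
move=> sf Ix Iy; have Ie := ideal_unit e0.
have right z : I z -> f (vmul z e) = f z * f (vmul e e).
  apply: (state_ortho e0 sf (ortho_vmulr e0)).
  by move=> w Iw; exact: ideal_mul.
have left z : I z -> 0 <=v z -> f (vmul z y) = f z * f y * f (vmul e e).
  move=> Iz z0; rewrite (state_ortho e0 sf (ortho_vmull z0))//.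
    by rewrite (right z Iz) mulrCA mulrA.
  by move=> w Iw; exact: ideal_mul.
have [Ip IpN] := (ideal_pos e0 Ix, ideal_pos e0 (idealN Ix)).
rewrite -(vpos_sub x) (linear_funB (vmulr_linear y)) !(stateB e0 sf)//.
- by rewrite !left ?vpos_ge0// !mulrBl.
- exact: ideal_mul.
- exact: ideal_mul.
Qed.

End state_product.

(** * The free algebra is the weighted algebra *)

Section canonical_hom.
Context {R : realType} {E : normedModType R}.

Fact evaluation_continuous (x : E) :
  continuous (fun k : dual_cylinder E => (\val k.2 : dual E) x).
Proof.
have evc : continuous (fun u : dual E => u x).
  apply: (@lipschitz_linear_continuous _ (dual E) R^o _ `|x|) => // u.
  by rewrite mulrC; exact: dual_le.
have svc : continuous (fun s : dual_sphere E => (\val s : dual E) x).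
  move=> s; apply: (@continuous_comp _ _ _ set_val (fun u : dual E => u x)).
    exact: initial_continuous.
  exact: evc.
move=> k; apply: (@continuous_comp _ _ _ snd
  (fun s : dual_sphere E => (\val s : dual E) x)).
  exact: cvg_snd.
exact: svc.
Qed.

Definition evaluation (x : E) : weightedC E :=
  (mkcts (@evaluation_continuous x) : continuousType _ _).

Lemma evaluationE x k : evaluation x k = (\val k.2 : dual E) x.
Proof. by []. Qed.

Lemma dual_sphere_norm (u : dual_sphere E) : `|\val u : dual E| = 1.
Proof. exact: set_valP u. Qed.

Lemma exists_canonical_hom (A : banachFAlgType R) (eta : E -> A) :
  compact [set: dual_cylinder E] ->
  (forall (B : banachFAlgType R) (T : E -> B), linear T -> contractive T ->
    exists2 That : A -> B, lattice_algebra_hom That & That \o eta = T) ->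
  exists2 Phi : A -> weightedC E, lattice_algebra_hom Phi &
    forall x, Phi (eta x) = evaluation x.
Proof.
move=> cX free.
have [||Phi homPhi PhiE] := free (supC cX : banachFAlgType R) evaluation.
- move=> a x y; apply: weightedC_ext => k.
  by rewrite evaluationE dual_linear.
- apply: ge_ereal_sup => _ [x /= x1 <-]; rewrite lee_fin.
  apply: supC_norm_le => // k; apply: le_trans x1.
  by rewrite (le_trans (dual_le _ _))// dual_sphere_norm mul1r.
- by exists Phi => // x; rewrite -PhiE.
Qed.

End canonical_hom.

Section representation.
Context {R : realType} {E : normedModType R} {A : banachFAlgType R}.
Context (eta : E -> A) (Phi : A -> weightedC E).
Hypothesis eta_linear : linear eta.
Hypothesis eta_le : forall x, `|eta x| <= `|x|.
Hypothesis hPhi : lattice_algebra_hom Phi.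
Hypothesis Phi_eta : forall x, Phi (eta x) = evaluation x.
Hypothesis cX : compact [set: dual_cylinder E].

Context {n : nat} (b : 'I_n -> E) (xi : 'I_n -> E -> R) (C : R).
Hypothesis C0 : 0 < C.
Hypothesis xiE : forall x, x = \sum_i xi i x *: b i.
Hypothesis xi_le : forall i x, `|xi i x| <= C * `|x|.

Local Notation X := (dual_cylinder E).
Implicit Types (x y : E) (a c : A) (k : X).

Let e : A := \sum_i vabs (eta (b i)).
Local Notation I := (principal_ideal e).

Let Pl := lahom_linear hPhi.

Let PhiD a c k : Phi (a + c) k = Phi a k + Phi c k.
Proof. by rewrite (linear_funD Pl). Qed.

Let PhiZ t a k : Phi (t *: a) k = t * Phi a k.
Proof. by rewrite (linear_funZ Pl). Qed.

Let PhiN a k : Phi (- a) k = - Phi a k.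
Proof. by rewrite (linear_funN Pl). Qed.

Let PhiB a c k : Phi (a - c) k = Phi a k - Phi c k.
Proof. by rewrite PhiD PhiN. Qed.

Let PhiJ a c k : Phi (vjoin a c) k = Num.max (Phi a k) (Phi c k).
Proof. by rewrite (lahom_join hPhi). Qed.

Let PhiM a c k : Phi (vmeet a c) k = Num.min (Phi a k) (Phi c k).
Proof. by rewrite (lahom_meet hPhi). Qed.

Let Phi_mul a c k : Phi (vmul a c) k = \val k.1 * Phi a k * Phi c k.
Proof. by rewrite (lahom_mul hPhi). Qed.

Let PhiEta x k : Phi (eta x) k = (\val k.2 : dual E) x.
Proof. by rewrite Phi_eta. Qed.

Let Phi_le a c k : a <=v c -> Phi a k <= Phi c k.
Proof.
by move=> ac; have := PhiJ c a k; rewrite vjoin_idPl// => ->;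
  rewrite le_max lexx orbT.
Qed.

Let e_ge0 : 0 <=v e.
Proof.
rewrite /e; elim/big_rec: _ => [|i x _ x0]; first exact: vle_refl.
by rewrite vaddr_ge0// vabs_ge0.
Qed.

Let vabs_eta_le i : vabs (eta (b i)) <=v e.
Proof.
rewrite /e (bigD1 i)//= vleDl//; elim/big_rec: _ => [|j x _ x0].
  exact: vle_refl.
by rewrite vaddr_ge0// vabs_ge0.
Qed.

Let Ie : I e := ideal_unit e_ge0.

Let I_eta_b i : I (eta (b i)).
Proof.
exists 1; rewrite scale1r; last exact: vle_trans (vabs_ge _) (vabs_eta_le i).
by rewrite -vleN2 opprK (vle_trans (vabs_geN _) (vabs_eta_le i)).
Qed.

Let I_eta x : I (eta x).
Proof.
rewrite (xiE x) (linear_fun_sum eta_linear); elim/big_rec: _ => [|i y _ Iy].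
  exact: ideal0 e_ge0.
by apply: idealD => //; rewrite (linear_funZ eta_linear); exact/idealZ.
Qed.

Let I_abs a : I a -> I (vabs a).
Proof. by move=> Ia; apply: ideal_join => //; exact: idealN. Qed.

Let Phi_e k : Phi e k = \sum_i `|(\val k.2 : dual E) (b i)|.
Proof.
rewrite /e (linear_fun_sum Pl); elim/big_ind2: _ => // [_ t _ s <- <- //|i _].
by rewrite PhiJ PhiN PhiEta maxrN.
Qed.

(** A functional u of norm 1 cannot be small on all basis vectors, because its
    values on the unit ball are combinations, with coefficients at most C, of
    its values on the basis. *)
Let Phi_e_ge k : 1 <= C * Phi e k.
Proof.
rewrite -[leLHS](dual_sphere_norm k.2) Phi_e; apply: dual_norm_le => x x1.
rewrite {1}(xiE x) linear_sum/= (le_trans (ler_norm_sum _ _ _))// mulr_sumr.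
apply: ler_sum => i _; rewrite linearZ/= normrM ler_wpM2r//.
by rewrite (le_trans (xi_le i x))// ler_piMr// ltW.
Qed.

Let Phi_e_gt0 k : 0 < Phi e k.
Proof. by rewrite -(pmulr_rgt0 _ C0) (lt_le_trans ltr01). Qed.

(** A state f restricts on E to a nonzero functional; dividing it by its norm
    rho gives the point u of the sphere, and r = rho f(e e) is the weight.  The
    bound r <= 1 comes from |eta x| e <= |x| e. *)
Let state_point f : lattice_state e f -> exists k rho,
  [/\ 0 < rho, forall x, f (eta x) = rho * Phi (eta x) k &
      f (vmul e e) * rho = \val k.1].
Proof.
move=> sf.
have fl : linear (f \o eta).
  by move=> t x y /=; rewrite eta_linear (state_linear sf).
have fle x : `|(f \o eta) x| <= (\sum_i C * `|f (eta (b i))|) * `|x|.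
  rewrite {1}(xiE x) (linear_fun_sum fl) (le_trans (ler_norm_sum _ _ _))//.
  rewrite mulr_suml; apply: ler_sum => i _.
  by rewrite (linear_funZ fl) normrM mulrAC ler_wpM2r.
pose u : dual E := Dual fl (@lipschitz_linear_continuous _ _ _ _ _ fl fle).
have u0 : 0 < `|u|.
  rewrite normr_gt0; apply/eqP => u0.
  have [_] := ideal_sum e_ge0 sf (fun i => I_abs (I_eta_b i)).
  rewrite -/e (state_unit sf) big1 => [/eqP|i _]; first by rewrite oner_eq0.
  rewrite (state_abs e_ge0 sf)//.
  by rewrite -[f (eta _)]/(u (b i)) u0 normr0.
have vS : `| (`|u|^-1) *: u| = 1 :> R.
  by rewrite normrZ normfV normr_id mulVf ?gt_eqF.
have Iee := ideal_mul e_ge0 Ie Ie.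
have m0 : 0 <= f (vmul e e) by rewrite (state_ge0 e_ge0 sf)// vmul_ge0.
have rI : f (vmul e e) * `|u| \in `[0, 1].
  rewrite in_itv/= mulr_ge0//=.
  have [->|m_neq0] := eqVneq (f (vmul e e)) 0; first by rewrite mul0r.
  have m_gt0 : 0 < f (vmul e e) by rewrite lt_neqAle eq_sym m_neq0.
  rewrite -ler_pdivlMl// mulr1; apply: dual_norm_le => x x1.
  rewrite -[leRHS]mulr1 ler_pdivlMl// mulrC -[u x]/(f (eta x)).
  have Iax := I_abs (I_eta x).
  have := state_mul e_ge0 sf Iax Ie.
  rewrite (state_unit sf) mulr1 (state_abs e_ge0 sf)// => <-.
  rewrite -[leRHS](state_unit sf).
  apply: (state_le sf) => //; first exact: ideal_mul.
  apply: vle_trans (vmul_le (vabs_ge0 _) e_ge0) _.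
  rewrite -{2}[e]scale1r vle_wZ// vnorm_abs.
  exact: le_trans (eta_le x) x1.
have rS : `[0, 1]%classic (f (vmul e e) * `|u|) by exact: rI.
have vS' : [set w : dual E | `|w| = 1] (`|u|^-1 *: u) by exact: vS.
pose r : unit_interval R := exist _ (f (vmul e e) * `|u|) (mem_set rS).
pose v : dual_sphere E := exist _ (`|u|^-1 *: u) (mem_set vS').
exists (r, v), `|u|; split=> // x.
rewrite PhiEta [(\val _ : dual E) x]/(`|u|^-1 * u x).
by rewrite mulrA mulfV ?gt_eqF// mul1r.
Qed.

(** The elements on which every state is, up to the factor rho, the evaluation
    at the point that it determines.  They form a subalgebra and sublattice, closed for
    e-uniform convergence, that contains the image of E. *)
Let repr a := I a /\ forall f rho k, lattice_state e f -> 0 < rho ->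
  (forall x, f (eta x) = rho * Phi (eta x) k) ->
  f (vmul e e) * rho = \val k.1 -> f a = rho * Phi a k.

Let repr_eta x : repr (eta x).
Proof. by split=> // f rho k _ _; exact. Qed.

Let reprD a c : repr a -> repr c -> repr (a + c).
Proof.
move=> [Ia ra] [Ic rc]; split=> [|f rho k sf r0 fE wE]; first exact: idealD.
rewrite (stateD sf)// PhiD mulrDr.
by rewrite (ra _ _ _ sf r0 fE wE) (rc _ _ _ sf r0 fE wE).
Qed.

Let reprZ t a : repr a -> repr (t *: a).
Proof.
move=> [Ia ra]; split=> [|f rho k sf r0 fE wE]; first exact: idealZ.
by rewrite (stateZ e_ge0 sf)// PhiZ mulrCA (ra _ _ _ sf r0 fE wE).
Qed.

Let reprN a : repr a -> repr (- a).
Proof. by rewrite -scaleN1r; exact: reprZ. Qed.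

Let reprB a c : repr a -> repr c -> repr (a - c).
Proof. by move=> ra rc; apply: reprD => //; exact: reprN. Qed.

Let reprJ a c : repr a -> repr c -> repr (vjoin a c).
Proof.
move=> [Ia ra] [Ic rc]; split=> [|f rho k sf r0 fE wE]; first exact: ideal_join.
rewrite (state_join sf)// PhiJ maxr_pMr ?(ltW r0)//.
by rewrite (ra _ _ _ sf r0 fE wE) (rc _ _ _ sf r0 fE wE).
Qed.

Let reprM a c : repr a -> repr c -> repr (vmeet a c).
Proof.
move=> ra rc; rewrite -[vmeet a c]opprK oppr_vmeet.
by apply/reprN/reprJ; exact: reprN.
Qed.

Let repr_mul a c : repr a -> repr c -> repr (vmul a c).
Proof.
move=> [Ia ra] [Ic rc]; split=> [|f rho k sf r0 fE wE]; first exact: ideal_mul.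
rewrite (state_mul e_ge0 sf)// Phi_mul -wE.
by rewrite (ra _ _ _ sf r0 fE wE) (rc _ _ _ sf r0 fE wE); ring.
Qed.

Let repr_e : repr e.
Proof.
rewrite /e; elim/big_rec: _ => [|i x _ rx].
  by rewrite -(linear_fun0 eta_linear); exact: repr_eta.
by apply: reprD => //; apply: reprJ; [|apply: reprN]; exact: repr_eta.
Qed.

Let repr_lim a : (forall d, 0 < d ->
  exists2 c, repr c & c - d *: e <=v a /\ a <=v c + d *: e) -> repr a.
Proof.
move=> lim_a.
have Ia : I a.
  have [c [Ic _] [ca ac]] := lim_a 1 ltr01.
  by apply: (ideal_squeeze e_ge0 _ _ ca ac);
    apply: idealD => //; rewrite scale1r//; exact: idealN.
split=> // f rho k sf r0 fE wE; apply/eqP; rewrite -subr_eq0 -normr_le0.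
apply/ler_addgt0Pr => t t0; rewrite add0r.
have q0 : 0 < 1 + rho * Phi e k by rewrite addr_gt0// mulr_gt0.
pose d := t / (1 + rho * Phi e k); have d0 : 0 < d by rewrite divr_gt0.
have -> : t = d + rho * (d * Phi e k).
  by rewrite /d; field; rewrite gt_eqF.
have [c [Ic rc] [ca ac]] := lim_a d d0; have Ide := idealZ d Ie.
have := Phi_le k ca; have := Phi_le k ac.
have := state_le sf (idealD Ic (idealN Ide)) Ia ca.
have := state_le sf Ia (idealD Ic Ide) ac.
rewrite (stateB e_ge0 sf)// (stateD sf)// (stateZ e_ge0 sf)// (state_unit sf).
rewrite PhiB PhiD PhiZ mulr1 (rc _ _ _ sf r0 fE wE).
move=> h1 h2 /(ler_wpM2l (ltW r0)) h3 /(ler_wpM2l (ltW r0)) h4.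
by move: h1 h2 h3 h4; rewrite mulrBr mulrDr ler_norml => *; lra.
Qed.

Let repr_le0 a : repr a -> (forall k, Phi a k <= 0) -> a <=v 0.
Proof.
move=> [Ia ra] a0; apply: contrapT => na0.
have archi c : (forall t : R, 0 < t -> c <=v t *: e) -> c <=v 0.
  exact: vle_archi.
have [f sf fa] := exists_state_gt0 e_ge0 archi Ia na0.
have [k [rho [r0 fE wE]]] := state_point sf.
move: fa; rewrite (ra _ _ _ sf r0 fE wE) pmulr_rgt0//.
by rewrite ltNge a0.
Qed.

Let repr_le a c d : repr a -> repr c -> 0 <= d ->
  (forall k, Phi a k <= Phi c k + d) -> a <=v c + (C * d) *: e.
Proof.
move=> ra rc d0 ac; rewrite -vsubr_le0; apply: repr_le0 => [|k].
  by apply: reprB => //; apply: reprD => //; exact: reprZ.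
rewrite PhiB PhiD PhiZ subr_le0 (le_trans (ac k))// lerD2l.
by rewrite mulrAC ler_peMl.
Qed.

Let repr_inj a c : repr a -> repr c -> Phi a = Phi c -> a = c.
Proof.
move=> ra rc ac; apply: vle_eq; rewrite -vsubr_le0.
  by apply: repr_le0 => [|k]; [exact: reprB|rewrite PhiB ac subrr].
by apply: repr_le0 => [|k]; [exact: reprB|rewrite PhiB ac subrr].
Qed.

(** If the values at k = (r, u) and l = (s, v) were proportional for every
    represented element, then u and v would be positively proportional by the
    elements eta x, hence equal as both have norm 1, and the element e e would
    give r = s. *)
Let repr_sep k l : k <> l ->
  exists2 a, repr a & Phi a k * Phi e l != Phi a l * Phi e k.
Proof.
move=> kl; apply: contrapT => H; apply: kl.
have {}H a : repr a -> Phi a k * Phi e l = Phi a l * Phi e k.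
  by move=> ra; apply: contrapT => /eqP nE; apply: H; exists a.
case: k l H => [[r r01] [u u1]] [[s s01] [v v1]] H.
set k := (_, _) in H; set l := (_, _) in H.
have [ek el] := (Phi_e_gt0 k, Phi_e_gt0 l).
pose t : R := Phi e k / Phi e l; have t0 : 0 < t by exact: divr_gt0.
have tE : t * Phi e l = Phi e k by rewrite mulfVK ?gt_eqF.
have uE : u = t *: v.
  apply: dual_ext => x; apply: (mulIf (lt0r_neq0 el)).
  have := H _ (repr_eta x); rewrite !PhiEta/= -tE => ->.
  by rewrite /= mulrCA mulrA.
have t1 : t = 1.
  have nu : `|u| = 1 by exact: set_mem u1.
  have nv : `|v| = 1 by exact: set_mem v1.
  by move: nu; rewrite uE normrZ nv mulr1 gtr0_norm.
have uv : u = v by rewrite uE t1 scale1r.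
have rs : r = s.
  have := H _ (repr_mul repr_e repr_e); rewrite !Phi_mul/= -tE t1 mul1r.
  by do 3 (move/mulIf; rewrite gt_eqF// => /(_ isT)).
by congr (_, _); exact: val_inj.
Qed.

(** Solve a two by two linear system for a combination of e and the element
    given by separation. *)
Let repr_interp (g : X -> R) k l :
  exists2 a, repr a & Phi a k = g k /\ Phi a l = g l.
Proof.
have [ek el] := (Phi_e_gt0 k, Phi_e_gt0 l).
have [<-|kl] := pselect (k = l).
  exists ((g k / Phi e k) *: e); first exact: reprZ.
  by rewrite PhiZ mulfVK ?gt_eqF.
have [a ra] := repr_sep kl; rewrite -subr_eq0.
(* D is the determinant of the system with columns (a, e) at k and l. *)
set D := _ - _ => D0.
exists (((g k * Phi e l - g l * Phi e k) / D) *: a +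
        ((Phi a k * g l - Phi a l * g k) / D) *: e).
  by apply: reprD; exact: reprZ.
by rewrite !PhiD !PhiZ; split; rewrite /D; field.
Qed.

Let repr_dense (g : weightedC E) d : 0 < d ->
  exists2 a, repr a & forall k, g k - d < Phi a k < g k + d.
Proof.
move=> d0; pose L := [set h : X -> R | exists2 a, repr a & h = Phi a].
have gc : continuous g := @cts_fun _ _ (g : continuousType _ _).
have [|||||h [a ra ->] had] :=
  lattice_dense (L := L) cX _ _ _ _ gc d0; last 1 first.
- by exists a.
- by move=> _ [a _ ->]; exact: (@cts_fun _ _ (Phi a : continuousType _ _)).
- by exists (Phi e), e.
- move=> _ _ [a ra ->] [c rc ->]; exists (vmeet a c); first exact: reprM.
  by apply/funext => k; rewrite PhiM.
- move=> _ _ [a ra ->] [c rc ->]; exists (vjoin a c); first exact: reprJ.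
  by apply/funext => k; rewrite PhiJ.
- move=> k l; have [a ra akl] := repr_interp g k l.
  by exists (Phi a) => //; exists a.
Qed.

(** Elements whose images are close to g are close in norm, as e is an order
    unit with Phi e bounded below; their limit is a preimage of g. *)
Let repr_onto (g : weightedC E) : exists2 a, repr a & Phi a = g.
Proof.
(* The Cauchy filter of the approximate preimages. *)
pose S d := [set a | repr a /\ forall k, `|Phi a k - g k| <= d].
pose F := filter_from [set d : R | 0 < d] S.
have FF : ProperFilter F.
  apply: filter_from_proper => [|d /= d0].
    apply: filter_from_filter; first by exists 1 => /=.
    move=> d t d0 t0; exists (Num.min d t); first by rewrite /= lt_min d0.
    by move=> a [ra adt]; split; split=> // k; have := adt k;
      rewrite le_min => /andP[].
  have [a ra ag] := repr_dense g d0; exists a; split=> // k.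
  by have /andP[? ?] := ag k; rewrite ler_norml; apply/andP; split; lra.
have SS a c d : 0 < d -> S d a -> S d c -> a <=v c + (C * (d + d)) *: e.
  move=> d0 [ra ad] [rc cd]; apply: repr_le => // [|k].
    by rewrite addr_ge0// ltW.
  have := ad k; have := cd k; rewrite !ler_norml => /andP[? ?] /andP[? ?].
  by lra.
have SSn a c d : 0 < d -> S d a -> S d c -> `|a - c| <= C * (d + d) * `|e|.
  move=> d0 Sa Sc.
  have m0 : 0 <= C * (d + d) by rewrite mulr_ge0 ?addr_ge0 ?ltW.
  rewrite -{1}(ger0_norm m0) -normrZ; apply: ler_vnorm.
  rewrite [vabs (_ *: e)]vabs_id ?vle_scale//; apply: vabs_le.
    by rewrite -(vle_add2r c) subrK addrC; exact: SS.
  by rewrite opprB -(vle_add2r a) subrK addrC; exact: SS.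
have S_ex d : 0 < d -> exists a, S d a.
  by move=> d0; apply: (@filter_ex _ F); exists d.
have cF : cauchy F.
  apply: cauchy_exP => t t0.
  have q0 : 0 < C * 2 * (`|e| + 1) by rewrite !mulr_gt0// ltr_wpDl.
  pose d := t / (C * 2 * (`|e| + 1)); have d0 : 0 < d by rewrite divr_gt0.
  have [a Sa] := S_ex d d0; exists a, d => // c Sc.
  rewrite -ball_normE /=; apply: le_lt_trans (SSn _ _ _ d0 Sa Sc) _.
  have -> : C * (d + d) * `|e| = t * (`|e| / (`|e| + 1)).
    by rewrite /d; field; rewrite !gt_eqF// ltr_wpDl.
  by rewrite gtr_pMr// ltr_pdivrMr ?mul1r ?ltrDl// ltr_wpDl.
have /cvg_ex[l Fl] : cvg F by exact: cauchy_cvg.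
have Sl d a : 0 < d -> S d a ->
    a <=v l + (C * (d + d)) *: e /\ l <=v a + (C * (d + d)) *: e.
  move=> d0 Sa.
  have near t : 0 < t -> exists2 c, S d c & `|l - c| <= t.
    move=> t0; have FS : F (S d) by exists d.
    have Fb : F (ball l t) by apply: Fl; exact: nbhsx_ballx.
    have [c [Sc]] := @filter_ex _ F _ _ (filterI FS Fb).
    by rewrite -ball_normE /= => /ltW ?; exists c.
  split; apply: vle_closed => t /near[c Sc lc].
    exists (c - l); first by rewrite distrC.
    by rewrite addrC addrA subrK; exact: SS.
  exists (l - c) => //; rewrite -(vle_add2r (c - l)) -addrA subrKA.
  by rewrite [l + _]addrC subrK subrr addr0; exact: SS.
have Cn0 : C != 0 by rewrite gt_eqF.
exists l.
  apply: repr_lim => t t0; have d0 : 0 < t / (2 * C).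
    by rewrite divr_gt0// mulr_gt0.
  have [c Sc] := S_ex _ d0; exists c; first by case: Sc.
  have := Sl _ _ d0 Sc.
  have -> : C * (t / (2 * C) + t / (2 * C)) = t by field.
  by move=> [ch hc]; split=> //; rewrite -(vle_add2r (t *: e)) subrK.
apply: weightedC_ext => k; apply/eqP; rewrite -subr_eq0 -normr_le0.
apply/ler_addgt0Pr => t t0; rewrite add0r.
have q0 : 0 < C * 2 * Phi e k + 1 by rewrite ltr_wpDl// !mulr_ge0 ?ltW.
pose d := t / (C * 2 * Phi e k + 1); have d0 : 0 < d by rewrite divr_gt0.
have tE : t = C * (d + d) * Phi e k + d by rewrite /d; field; rewrite gt_eqF.
have [a Sa] := S_ex _ d0; have [al la] := Sl _ _ d0 Sa.
have := Phi_le k al; have := Phi_le k la; rewrite !PhiD !PhiZ.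
case: Sa => _ /(_ k); rewrite !ler_norml => /andP[h1 h2] h3 h4.
by rewrite tE; apply/andP; split; lra.
Qed.

(** Represented elements being determined by their images and closed for all
    operations, the choice of a represented preimage is a homomorphism. *)
Lemma exists_section_hom : exists Psi : weightedC E -> A,
  [/\ lattice_algebra_hom Psi, forall x, Psi (evaluation x) = eta x &
      forall g, Phi (Psi g) = g].
Proof.
have /choice[Psi PsiP] : forall g, exists a, repr a /\ Phi a = g.
  by move=> g; have [a ra ag] := repr_onto g; exists a.
have rPsi g : repr (Psi g) by have [] := PsiP g.
have PsiK g : Phi (Psi g) = g by have [] := PsiP g.
have Psi_uniq g a : repr a -> Phi a = g -> Psi g = a.
  by move=> ra ag; apply: repr_inj; rewrite ?PsiK.
exists Psi; split=> //; last first.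
  by move=> x; apply: Psi_uniq; rewrite ?Phi_eta//; exact: repr_eta.
split=> [t g h|g h|g h|g h]; apply: Psi_uniq.
- by apply: reprD => //; exact: reprZ.
- by rewrite Pl !PsiK.
- exact: reprM.
- by rewrite (lahom_meet hPhi) !PsiK.
- exact: reprJ.
- by rewrite (lahom_join hPhi) !PsiK.
- exact: repr_mul.
- by rewrite (lahom_mul hPhi) !PsiK.
Qed.

End representation.

Lemma lattice_algebra_hom_id (R : numDomainType) (A : vectorLatticeAlgType R) :
  lattice_algebra_hom (@id A).
Proof. by split. Qed.

Lemma lattice_algebra_hom_comp (R : numDomainType)
    (A B D : vectorLatticeAlgType R) (f : B -> D) (g : A -> B) :
  lattice_algebra_hom f -> lattice_algebra_hom g ->
  lattice_algebra_hom (f \o g).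
Proof.
move=> [fl fm fj fM] [gl gm gj gM].
split=> [a x y|x y|x y|x y] /=.
- by rewrite gl fl.
- by rewrite gm fm.
- by rewrite gj fj.
- by rewrite gM fM.
Qed.

Theorem theorem4p16 (R : realType) (E : completeNormedModType R)
    (FBfA : banachFAlgType R) (eta : E -> FBfA) :
  finite_dimensional E ->
  is_free_banach_falgebra eta ->
  exists2 Phi : FBfA -> weightedC E,
    lattice_algebra_iso Phi &
    forall (x : E) (r : unit_interval R) (u : dual_sphere E),
      Phi (eta x) (r, u) = (\val u) x.
Proof.
move=> fd [eta_linear eta_isom free].
have cX := dual_cylinder_compact fd.
have [n [b [xi [C [C0 _ xiE xi_le]]]]] := finite_dimensional_basis fd.
have [|Phi hPhi Phi_eta] := @exists_canonical_hom R E FBfA eta cX.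
  move=> B T Tl Tc; have [That [hT TE _] _] := free B T Tl Tc.
  by exists That.
have eta_le x : `|eta x| <= `|x| by rewrite eta_isom.
have [Psi [hPsi Psi_eta PsiK]] :=
  exists_section_hom eta_linear eta_le hPhi Phi_eta cX C0 xiE xi_le.
exists Phi; last by move=> x r u; rewrite Phi_eta.
split=> //; exists Psi => //.
have eta_contr : contractive eta.
  by apply: ge_ereal_sup => _ [x /= x1 <-]; rewrite lee_fin eta_isom.
have [That _ uniq] := free FBfA eta eta_linear eta_contr.
have id_That : id = That by apply: uniq => //; exact: lattice_algebra_hom_id.
have PsiPhi : Psi \o Phi = That.
  apply: uniq; first exact: (lattice_algebra_hom_comp hPsi hPhi).
  by apply/funext => x /=; rewrite Phi_eta Psi_eta.
by move=> a; rewrite -[LHS]/((Psi \o Phi) a) PsiPhi -id_That.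
Qed.
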